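(* The following problem is decidable: given an automatic relation $R\subseteq\Sigma^*\times\Gamma^*$ (given by a regular synchronization language), decide whether there exists a subsequential transducer with finite shiftlag that uniformizes $R$.
   Context: $\Sigma$ (input) and $\Gamma$ (output) are disjoint finite alphabets. For $w\in(\Sigma\cup\Gamma)^*$ let $\llbracket w\rrbracket=(\pi_{\mathtt i}(w),\pi_{\mathtt o}(w))$, where $\pi_{\mathtt i}(w)$ (resp. $\pi_{\mathtt o}(w)$) is obtained from $w$ by deleting all letters of $\Gamma$ (resp. $\Sigma$); for $S\subseteq(\Sigma\cup\Gamma)^*$ (a synchronization language) let $\llbracket S\rrbracket=\{\llbracket w\rrbracket: w\in S\}$. A relation is automatic if it equals $\llbracket S\rrbracket$ for a regular $S\subseteq(\Sigma\Gamma)^*(\Sigma^*+\Gamma^* )$. A position $i$ of $w$ is $\geq k$-lagged if the absolute difference between the number of $\Sigma$-letters and $\Gamma$-letters in $w[1..i]$ is at least $k$. A shift of $w$ is a position $i\in\{1,\dots,|w|-1\}$ such that exactly one of $w[i],w[i+1]$ lies in $\Sigma$; two shifts $i<j$ are consecutive if no shift lies strictly between them. $\mathit{shiftlag}(w)$ is the maximal $n$ such that $w$ contains $n$ consecutive shifts that are all $\geq n$-lagged; for a language $L$, $\mathit{shiftlag}(L)=\sup_{w\in L}\mathit{shiftlag}(w)\in\mathbb N\cup\{\infty\}$. A subsequential transducer $\mathcal T$ consists of a finite state set $Q$, initial state $q_0$, a partial transition function $Q\times\Sigma\to\Gamma^*\times Q$, final states $F$ and a final output function $f:F\to\Gamma^*$;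 a run $q_0\xrightarrow{a_1|v_1}p_1\cdots\xrightarrow{a_n|v_n}p_n$ with $p_n\in F$ maps $a_1\cdots a_n$ to $v_1\cdots v_nf(p_n)$ and contributes the word $a_1v_1a_2v_2\cdots a_nv_nf(p_n)$ to the synchronization language $S(\mathcal T)$. $\mathcal T$ has finite shiftlag if $S(\mathcal T)$ has finite shiftlag. A uniformization of $R$ is a function $g:\mathrm{dom}(R)\to\Gamma^*$ with $(u,g(u))\in R$ for all $u\in\mathrm{dom}(R)$; $\mathcal T$ uniformizes $R$ if the function it computes is a uniformization of $R$. *)

(* Defs.v *)
From mathcomp Require Import all_boot.
Set Implicit Arguments. Unset Strict Implicit. Unset Printing Implicit Defensive.

Inductive rf : Type :=
| RZero : rf
| RSucc : rf
| RProj : nat -> rf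
| RComp : rf -> list rf -> rf
| RPrec : rf -> rf -> rf
| RMu   : rf -> rf.

Inductive rf_eval : rf -> seq nat -> nat -> Prop :=
| ev_zero xs : rf_eval RZero xs 0
| ev_succ x xs : rf_eval RSucc (x :: xs) x.+1
| ev_proj i xs : i < size xs -> rf_eval (RProj i) xs (nth 0 xs i)
| ev_comp f gs xs ys y :
    rf_evals gs xs ys -> rf_eval f ys y -> rf_eval (RComp f gs) xs y
| ev_prec0 f g xs y : rf_eval f xs y -> rf_eval (RPrec f g) (0 :: xs) y
| ev_precS f g n xs z y :
    rf_eval (RPrec f g) (n :: xs) z -> rf_eval g (n :: z :: xs) y ->
    rf_eval (RPrec f g) (n.+1 :: xs) y
| ev_mu f xs n :
    rf_eval f (n :: xs) 0 ->
    (forall m, m < n -> exists k, rf_eval f (m :: xs) k.+1) ->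
    rf_eval (RMu f) xs n
with rf_evals : list rf -> seq nat -> seq nat -> Prop :=
| evs_nil xs : rf_evals nil xs [::]
| evs_cons g gs xs y ys :
    rf_eval g xs y -> rf_evals gs xs ys -> rf_evals (g :: gs) xs (y :: ys).

Definition npair (a b : nat) : nat := (a + b) * (a + b).+1 %/ 2 + b.
Fixpoint enc_list (l : seq nat) : nat :=
  if l is x :: l' then (npair x (enc_list l')).+1 else 0.

Definition decidable_promise (X : Type) (enc : X -> nat)
  (Pr : X -> Prop) (P : X -> Prop) : Prop :=
  exists p : rf, forall x, Pr x ->
    (P x -> rf_eval p [:: enc x] 1) /\ (~ P x -> rf_eval p [:: enc x] 0).

(* Letters are naturals: a < nsig is an input letter (Sigma),
   nsig <= a < nsig + ngam is an output letter (Gamma). *)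
Record nfa := NFA {
  nsig : nat;
  ngam : nat;
  ntrans : seq (nat * nat * nat);     (* transitions (p, a, q) *)
  ninit : seq nat;
  nfin : seq nat
}.

Definition encode_nfa (A : nfa) : nat :=
  npair (nsig A) (npair (ngam A)
    (npair (enc_list [seq npair (npair t.1.1 t.1.2) t.2 | t <- ntrans A])
       (npair (enc_list (ninit A)) (enc_list (nfin A))))).

Definition isSig (ns : nat) (a : nat) : bool := a < ns.
Definition isGam (ns ng : nat) (a : nat) : bool := (ns <= a) && (a < ns + ng).

Definition nstep (A : nfa) (S : seq nat) (a : nat) : seq nat :=
  [seq t.2 | t <- ntrans A & (t.1.1 \in S) && (t.1.2 == a)].

Definition nacc (A : nfa) (w : seq nat) : bool :=
  has (fun q => q \in nfin A) (foldl (nstep A) (ninit A) w).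

Definition proj_i (ns : nat) (w : seq nat) := filter (isSig ns) w.
Definition proj_o (ns ng : nat) (w : seq nat) := filter (isGam ns ng) w.

Definition sync_shape (ns ng : nat) (w : seq nat) : Prop :=
  exists (ps : seq (nat * nat)) (v : seq nat),
    [/\ w = flatten [seq [:: p.1; p.2] | p <- ps] ++ v,
        all (isSig ns) (unzip1 ps), all (isGam ns ng) (unzip2 ps) &
        all (isSig ns) v || all (isGam ns ng) v].

Definition automatic_presentation (A : nfa) : Prop :=
  forall w, nacc A w -> sync_shape (nsig A) (ngam A) w.

Definition relA (A : nfa) (u v : seq nat) : Prop :=
  exists w, nacc A w /\ proj_i (nsig A) w = u /\ proj_o (nsig A) (ngam A) w = v.

Definition domA (A : nfa) (u : seq nat) : Prop := exists v, relA A u v.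

Definition absdiff (m n : nat) : nat := (m - n) + (n - m).

Definition lag (ns ng : nat) (w : seq nat) (i : nat) : nat :=
  absdiff (count (isSig ns) (take i w)) (count (isGam ns ng) (take i w)).

(* i (1-indexed, 1 <= i <= |w|-1) is a shift: exactly one of w[i], w[i+1]
   lies in Sigma *)
Definition is_shift (ns : nat) (w : seq nat) (i : nat) : bool :=
  [&& 1 <= i, i < size w & isSig ns (nth 0 w i.-1) (+) isSig ns (nth 0 w i)].

Definition shifts (ns : nat) (w : seq nat) : seq nat :=
  [seq i <- iota 1 (size w).-1 | is_shift ns w i].

Definition has_lagged_shifts (ns ng : nat) (w : seq nat) (n : nat) : Prop :=
  exists k, k + n <= size (shifts ns w) /\
    all (fun i => n <= lag ns ng w i) (take n (drop k (shifts ns w))).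

Definition finite_shiftlag (ns ng : nat) (L : seq nat -> Prop) : Prop :=
  exists B : nat, forall w, L w ->
    forall n, has_lagged_shifts ns ng w n -> n <= B.

Record sst (Q : finType) := SST {
  st_init : Q;
  st_delta : Q -> nat -> option (seq nat * Q);
  st_final : Q -> option (seq nat)               (* Some z iff final, f = z *)
}.

Definition sst_wf (ns ng : nat) (Q : finType) (T : sst Q) : Prop :=
  (forall q a v q', isSig ns a -> st_delta T q a = Some (v, q') ->
     all (isGam ns ng) v) /\
  (forall q z, st_final T q = Some z -> all (isGam ns ng) z).

Fixpoint sst_run (Q : finType) (T : sst Q) (q : Q) (u : seq nat)
  : option (Q * seq nat * seq nat) :=
  match u with
  | [::] => Some (q, [::], [::])
  | a :: u' =>
    match st_delta T q a with
    | None => None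
    | Some (v, q') =>
      match sst_run T q' u' with
      | None => None
      | Some (p, s, o) => Some (p, a :: v ++ s, v ++ o)
      end
    end
  end.

Definition sst_accept (Q : finType) (T : sst Q) (u : seq nat)
  : option (seq nat * seq nat) :=
  match sst_run T (st_init T) u with
  | None => None
  | Some (p, s, o) =>
    match st_final T p with
    | None => None
    | Some z => Some (s ++ z, o ++ z)
    end
  end.

Definition sst_fun (ns : nat) (Q : finType) (T : sst Q) (u : seq nat)
  : option (seq nat) :=
  if all (isSig ns) u then omap snd (sst_accept T u) else None.

Definition sst_sync (ns : nat) (Q : finType) (T : sst Q) (w : seq nat) : Prop :=
  exists u, all (isSig ns) u /\ omap fst (sst_accept T u) = Some w.

Definition uniformizes (ns : nat) (Q : finType) (T : sst Q)
  (R : seq nat -> seq nat -> Prop) : Prop :=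
  (forall u, (exists v, R u v) <-> (exists v, sst_fun ns T u = Some v)) /\
  (forall u v, sst_fun ns T u = Some v -> R u v).

Definition has_finite_shiftlag_uniformizer (A : nfa) : Prop :=
  exists (Q : finType) (T : sst Q),
    [/\ sst_wf (nsig A) (ngam A) T,
        finite_shiftlag (nsig A) (ngam A) (sst_sync (nsig A) T) &
        uniformizes (nsig A) T (relA A)].

(* Main.v *)
(* Read a deterministic automaton for R on interleaved words, and let d bound
   the number of profiles of input words, where the profile of x records how the
   words made of x and of an output at most as long as x act on the automaton.
   A transducer of finite shiftlag keeps its lag bounded, except that it may fall
   so far behind that only boundedly many output letters are left to write.  It
   is therefore a strategy in a game in which, with a block of pending input,
   one reads the next block and either writes a block of output or claims that a
   bounded output suffices for all continuations.  Pumping a block of length d to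
   a longer one of the same profile turns a transducer of arbitrary lag into a
   strategy for blocks of length d; conversely a strategy for blocks of length d
   is a transducer of lag at most 2d until it makes that claim.  Blocks of length d make the game finite,
   its positions being (state of the automaton, pending block), and the
   quantifiers over continuations are bounded since words may be replaced by
   short words of the same profile.  So the winning region is the greatest
   fixpoint of a computable operator on a finite list. *)
Require Import Defs.
From mathcomp Require Import all_boot zify.
Set Implicit Arguments. Unset Strict Implicit. Unset Printing Implicit Defensive.

(** * Computable functions between encodable types *)

(** The arity only selects the argument lists on which the program must agree with [F], so plain
    functions on sequences serve and no type of vectors appears. *)
Definition recursive (n : nat) (F : seq nat -> nat) :=
  exists p, forall xs, size xs = n -> rf_eval p xs (F xs).

Lemma recursive_ext n F G : (forall xs, size xs = n -> F xs = G xs) ->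
  recursive n F -> recursive n G.
Proof. by move=> e [p hp]; exists p => xs hs; rewrite -e //; apply: hp. Qed.

Lemma recursive_nth n i : i < n -> recursive n (fun xs => nth 0 xs i).
Proof. by move=> h; exists (RProj i) => xs hs; apply: ev_proj; rewrite hs. Qed.

Lemma recursive_comp n (Fs : seq (seq nat -> nat)) G :
  recursive (size Fs) G ->
  (forall F, List.In F Fs -> recursive n F) ->
  recursive n (fun xs => G [seq F xs | F <- Fs]).
Proof.
case=> p hp hF.
suff [ps hps] : exists ps, forall xs, size xs = n ->
    rf_evals ps xs [seq F xs | F <- Fs].
  exists (RComp p ps) => xs hs; apply: ev_comp (hps _ hs) _.
  by apply: hp; rewrite size_map.
elim: Fs hF {hp} => [|F Fs IH] hF; first by exists [::] => xs _; apply: evs_nil.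
have [q hq] := hF F (or_introl erefl).
have [ps hps] := IH (fun F' h => hF F' (or_intror h)).
by exists (q :: ps) => xs hs /=; apply: evs_cons; [apply: hq|apply: hps].
Qed.

Lemma recursive_comp1 n F (g : nat -> nat) :
  recursive 1 (fun xs => g (nth 0 xs 0)) -> recursive n F ->
  recursive n (fun xs => g (F xs)).
Proof.
move=> hg hF; apply: (@recursive_comp n [:: F] (fun xs => g (nth 0 xs 0))) => //.
by move=> F' /= [<-|[]].
Qed.

Lemma recursive_comp2 n F1 F2 (g : nat -> nat -> nat) :
  recursive 2 (fun xs => g (nth 0 xs 0) (nth 0 xs 1)) ->
  recursive n F1 -> recursive n F2 ->
  recursive n (fun xs => g (F1 xs) (F2 xs)).
Proof.
move=> hg h1 h2.
apply: (@recursive_comp n [:: F1; F2] (fun xs => g (nth 0 xs 0) (nth 0 xs 1))) => //.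
by move=> F' /= [<-|[<-|[]]].
Qed.

Lemma recursive_succ n F : recursive n F -> recursive n (fun xs => (F xs).+1).
Proof.
move=> hF; apply: (recursive_comp1 (g := succn)) => //.
by exists RSucc => -[|x [|]] // _; apply: ev_succ.
Qed.

Lemma recursive_const n k : recursive n (fun=> k).
Proof.
elim: k => [|k IH]; first by exists RZero => xs _; apply: ev_zero.
exact: recursive_succ.
Qed.

Lemma recursive_prec n F G :
  recursive n F -> recursive n.+2 G ->
  recursive n.+1 (fun xs => nat_rec (fun=> nat) (F (behead xs))
    (fun k z => G (k :: z :: behead xs)) (nth 0 xs 0)).
Proof.
case=> p hp [q hq]; exists (RPrec p q) => -[//|m xs] [hs] /=.
elim: m => [|m IH] /=; first by apply: ev_prec0; apply: hp.
by apply: ev_precS IH _; apply: hq; rewrite /= hs.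
Qed.

Lemma recursive_addn n F G : recursive n F -> recursive n G ->
  recursive n (fun xs => F xs + G xs).
Proof.
apply: recursive_comp2.
have := recursive_prec (@recursive_nth 1 0 isT)
  (recursive_succ (@recursive_nth 3 1 isT)).
apply: recursive_ext => -[|m [|k [|]]] //= _.
by elim: m => //= m ->.
Qed.

Lemma recursive_predn n F : recursive n F -> recursive n (fun xs => (F xs).-1).
Proof.
apply: recursive_comp1.
have := recursive_prec (recursive_const 0 0) (@recursive_nth 2 0 isT).
by apply: recursive_ext => -[|[|m] [|]].
Qed.

Lemma recursive_subn n F G : recursive n F -> recursive n G ->
  recursive n (fun xs => F xs - G xs).
Proof.
(* Primitive recursion runs on the first argument, and truncated subtraction iterates the
   predecessor along the subtrahend, so the arguments are swapped. *)
move=> hF hG; apply: (recursive_comp2 (g := fun x y => y - x) _ hG hF).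
have := recursive_prec (@recursive_nth 1 0 isT)
  (recursive_predn (@recursive_nth 3 1 isT)).
apply: recursive_ext => -[|m [|k [|]]] //= _.
by elim: m => [|m /= ->]; rewrite ?subn0 ?subnS.
Qed.

(** * Triangular numbers and the inverse of the Cantor pairing *)

Definition tri n := nat_rec (fun=> nat) 0 (fun k z => z + k.+1) n.

Lemma recursive_tri n F : recursive n F -> recursive n (fun xs => tri (F xs)).
Proof.
apply: recursive_comp1.
have := recursive_prec (recursive_const 0 0)
  (recursive_addn (@recursive_nth 2 1 isT) (recursive_succ (@recursive_nth 2 0 isT))).
by apply: recursive_ext => -[|m [|]].
Qed.

Lemma triE n : tri n = (n * n.+1) %/ 2.
Proof.
elim: n => //= n ->.
by rewrite addnC -divnMDl //; congr (_ %/ _); nia.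
Qed.

(** Trades the division in [npair] for the recursion [tri], which is directly computable. *)
Lemma npairE a b : npair a b = tri (a + b) + b.
Proof. by rewrite triE. Qed.

(** The index of the diagonal of the Cantor pairing that contains [m]. From [k] to [k.+1] it grows
    exactly when [k.+1] equals [tri z.+1]; the truncated difference [k.+2 - tri z.+1] is 1 in that
    case and 0 otherwise. *)
Definition diag m := nat_rec (fun=> nat) 0 (fun k z => z + (k.+2 - tri z.+1)) m.

Lemma diagP m : tri (diag m) <= m < tri (diag m).+1.
Proof.
elim: m => //= m; set s := diag m; set t := tri s => /andP[h1 h2].
have [h|h] := eqVneq m.+1 (t + s.+1).
  by rewrite (_ : m.+2 - _ = 1) ?addn1 /= -/t; lia.
by rewrite (_ : m.+2 - _ = 0) ?addn0 -/t; lia.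
Qed.

Lemma leq_tri m n : m <= n -> tri m <= tri n.
Proof.
elim: n => [|n IH]; first by rewrite leqn0 => /eqP->.
by rewrite leq_eqVlt => /orP[/eqP->//|/IH h]; apply: leq_trans h (leq_addr _ _).
Qed.

Lemma diag_npair a b : diag (npair a b) = a + b.
Proof.
have := diagP (npair a b); rewrite npairE; set s := diag _ => h.
have triS k : tri k.+1 = tri k + k.+1 by [].
case: (ltngtP s (a + b)) => // hs; have := leq_tri hs; have := triS s;
  have := triS (a + b); lia.
Qed.

Definition unpair2 m := m - tri (diag m).
Definition unpair1 m := diag m - unpair2 m.

Lemma npairK1 a b : unpair1 (npair a b) = a.
Proof. by rewrite /unpair1 /unpair2 diag_npair npairE; lia. Qed.

Lemma npairK2 a b : unpair2 (npair a b) = b.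
Proof. by rewrite /unpair2 diag_npair npairE; lia. Qed.

Lemma recursive_npair n F G : recursive n F -> recursive n G ->
  recursive n (fun xs => npair (F xs) (G xs)).
Proof.
move=> hF hG; apply: (recursive_ext (F := fun xs => tri (F xs + G xs) + G xs)).
  by move=> xs _; rewrite npairE.
by apply: recursive_addn => //; apply: recursive_tri; apply: recursive_addn.
Qed.

Lemma recursive_diag n F : recursive n F -> recursive n (fun xs => diag (F xs)).
Proof.
apply: recursive_comp1.
have h i : i < 2 -> recursive 2 (fun xs => nth 0 xs i) by apply: recursive_nth.
have := recursive_prec (recursive_const 0 0)
  (recursive_addn (h 1 isT) (recursive_subn
    (recursive_succ (recursive_succ (h 0 isT)))
    (recursive_tri (recursive_succ (h 1 isT))))).
by apply: recursive_ext => -[|m [|]].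
Qed.

Lemma recursive_unpair2 n F :
  recursive n F -> recursive n (fun xs => unpair2 (F xs)).
Proof.
by move=> hF; apply: recursive_subn => //; apply/recursive_tri/recursive_diag.
Qed.

Lemma recursive_unpair1 n F :
  recursive n F -> recursive n (fun xs => unpair1 (F xs)).
Proof.
by move=> hF; apply: recursive_subn; [apply: recursive_diag|apply: recursive_unpair2].
Qed.

(* The default value is what [head] returns on an empty list. *)
Class encodable (T : Type) := Encodable {
  enc : T -> nat;
  enc_inj : injective enc;
  default : T
}.

#[export] Instance encodable_nat : encodable nat :=
  @Encodable nat id (fun _ _ => id) 0.

Lemma nat_of_bool_inj : injective nat_of_bool.
Proof. by case; case. Qed.

#[export] Instance encodable_bool : encodable bool :=
  @Encodable bool nat_of_bool nat_of_bool_inj false.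

Section Prod.
Context {S T : Type} {eS : encodable S} {eT : encodable T}.
Definition enc_pair (p : S * T) := npair (enc p.1) (enc p.2).
Lemma enc_pair_inj : injective enc_pair.
Proof.
move=> [a b] [c d] /= h; congr pair; apply: enc_inj.
  by rewrite -(npairK1 (enc a) (enc b)) [npair _ _]h npairK1.
by rewrite -(npairK2 (enc a) (enc b)) [npair _ _]h npairK2.
Qed.
End Prod.

#[export] Instance encodable_prod S T (eS : encodable S) (eT : encodable T) :
  encodable (S * T) := Encodable enc_pair_inj (default, default).

Section Seq.
Context {T : Type} {eT : encodable T}.
Definition enc_seq (l : seq T) := enc_list (map enc l).
Lemma enc_seq_inj : injective enc_seq.
Proof.
elim=> [|x s IH] [|y s'] //= [] h; rewrite /enc_seq /= in h.
have := congr1 unpair1 h; have := congr1 unpair2 h.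
by rewrite !npairK1 !npairK2 => /IH -> e; rewrite (enc_inj e).
Qed.
End Seq.

#[export] Instance encodable_seq T (eT : encodable T) : encodable (seq T) :=
  Encodable enc_seq_inj [::].

(** * Closure properties of computable functions *)

Section Computable.

(** Programs are unary on codes: several arguments travel as one coded tuple, and a function with a
    parameter is handled through the pair of parameter and argument. *)
Definition computable (X Y : Type) {eX : encodable X} {eY : encodable Y}
    (f : X -> Y) :=
  exists p, forall x, rf_eval p [:: enc x] (enc (f x)).

Context {X : Type} {eX : encodable X}.

Section Generic.
Context {Y Z : Type} {eY : encodable Y} {eZ : encodable Z}.

Lemma computable_ext (f g : X -> Y) : f =1 g -> computable f -> computable g.
Proof. by move=> e [p hp]; exists p => x; rewrite -e. Qed.

(** Only codes matter, so the codomain may change its type; projections and list operations are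
    obtained in this way from arithmetic on codes. *)
Lemma computable_enc (f : X -> Y) (g : X -> Z) :
  (forall x, enc (f x) = enc (g x)) -> computable f -> computable g.
Proof. by move=> e [p hp]; exists p => x; rewrite -e. Qed.

Lemma computable_comp (f : X -> Y) (g : Y -> Z) :
  computable f -> computable g -> computable (fun x => g (f x)).
Proof.
move=> [p hp] [q hq]; exists (RComp q [:: p]) => x.
by apply: ev_comp (hq _); apply: evs_cons (hp x) (evs_nil _).
Qed.
End Generic.

Lemma computable_id : computable (fun x : X => x).
Proof. by exists (RProj 0) => x; apply: (@ev_proj 0). Qed.

Lemma computable_recursive (F : nat -> nat) (f : X -> nat) :
  recursive 1 (fun xs => F (nth 0 xs 0)) -> computable f ->
  computable (fun x => F (f x)).
Proof.
move=> [q hq] hf; apply: (computable_comp (g := F)) => //.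
by exists q => x; apply: (hq [:: x]).
Qed.

Lemma computable_nat_const (k : nat) : computable (fun _ : X => k).
Proof.
have [p hp] := recursive_const 1 k.
by exists p => x; apply: hp.
Qed.

Context {Y Z : Type} {eY : encodable Y} {eZ : encodable Z}.

Lemma computable_const (y : Y) : computable (fun _ : X => y).
Proof. by apply: computable_enc (computable_nat_const (enc y)). Qed.

Lemma computable_pair (f : X -> Y) (g : X -> Z) :
  computable f -> computable g -> computable (fun x => (f x, g x)).
Proof.
move=> [p hp] [q hq].
have [r hr] := recursive_npair (@recursive_nth 2 0 isT) (@recursive_nth 2 1 isT).
exists (RComp r [:: p; q]) => x.
apply: ev_comp (hr [:: enc (f x); enc (g x)] erefl).
by apply: evs_cons (hp x) _; apply: evs_cons (hq x) (evs_nil _).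
Qed.

Lemma computable_fst (f : X -> Y * Z) :
  computable f -> computable (fun x => (f x).1).
Proof.
move=> hf.
apply: (computable_enc (f := fun x => unpair1 (enc (f x)))) => [x|].
  by rewrite [LHS]npairK1.
apply: computable_recursive.
  exact: recursive_unpair1 (recursive_nth _).
exact: computable_enc hf.
Qed.

Lemma computable_snd (f : X -> Y * Z) :
  computable f -> computable (fun x => (f x).2).
Proof.
move=> hf.
apply: (computable_enc (f := fun x => unpair2 (enc (f x)))) => [x|].
  by rewrite [LHS]npairK2.
apply: computable_recursive.
  exact: recursive_unpair2 (recursive_nth _).
exact: computable_enc hf.
Qed.

Lemma computable_iter (n : X -> nat) (h : X -> Y -> Y) (g : X -> Y) :
  computable n -> computable g -> computable (fun p => h p.1 p.2) ->
  computable (fun x => iter (n x) (h x) (g x)).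
Proof.
move=> [pn hn] [pg hg] [ph hh].
(* The step of the recursion receives the counter, the current value and the parameter; [r] drops
   the counter and packs the other two as the code of a pair. *)
have [r hr] := recursive_npair (@recursive_nth 3 2 isT) (@recursive_nth 3 1 isT).
exists (RComp (RPrec pg (RComp ph [:: r])) [:: pn; RProj 0]) => x.
apply: (ev_comp (ys := [:: n x; enc x])).
  apply: evs_cons (hn x) _; apply: evs_cons (evs_nil _).
  exact: (@ev_proj 0).
elim: (n x) => [|k IH]; first exact: ev_prec0.
apply: ev_precS IH _; set y := iter k _ _.
apply: ev_comp (evs_cons (hr [:: k; enc y; enc x] erefl) (evs_nil _)) _.
exact: (hh (x, y)).
Qed.

Lemma computable_succn (f : X -> nat) :
  computable f -> computable (fun x => (f x).+1).
Proof. by apply: computable_recursive; apply: recursive_succ (recursive_nth _). Qed.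

Lemma computable_predn (f : X -> nat) :
  computable f -> computable (fun x => (f x).-1).
Proof. by apply: computable_recursive; apply: recursive_predn (recursive_nth _). Qed.

End Computable.

Section ComputableNat.
Context {X : Type} {eX : encodable X}.
Implicit Types (f g : X -> nat) (b c : X -> bool).

Lemma computable_if {Y : Type} {eY : encodable Y} b (f g : X -> Y) :
  computable b -> computable f -> computable g ->
  computable (fun x => if b x then f x else g x).
Proof.
move=> hb hf hg.
(* A boolean is coded by 0 or 1, so a conditional is an iteration of length at most one. *)
apply: (computable_ext (f := fun x => iter (b x) (fun _ => f x) (g x))).
  by move=> x; case: (b x).
apply: computable_iter => //.
by apply: (computable_comp (f := fst) _ hf); apply/computable_fst/computable_id.
Qed.

Lemma computable_andb b c :
  computable b -> computable c -> computable (fun x => b x && c x).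
Proof. by move=> hb hc; apply: (computable_if hb hc); apply: computable_const. Qed.

Lemma computable_orb b c :
  computable b -> computable c -> computable (fun x => b x || c x).
Proof. by move=> hb hc; apply: (computable_if hb _ hc); apply: computable_const. Qed.

Lemma computable_implyb b c :
  computable b -> computable c -> computable (fun x => b x ==> c x).
Proof. by move=> hb hc; apply: (computable_if hb hc); apply: computable_const. Qed.

Lemma computable_addn f g :
  computable f -> computable g -> computable (fun x => f x + g x).
Proof.
move=> hf hg; apply: (computable_ext (f := fun x => iter (f x) succn (g x))).
  by move=> x; rewrite iter_succn addnC.
apply: (computable_iter (h := fun _ => succn)) => //.
by apply/computable_succn/computable_snd/computable_id.
Qed.

Lemma computable_subn f g :
  computable f -> computable g -> computable (fun x => f x - g x).
Proof.
move=> hf hg; apply: (computable_ext (f := fun x => iter (g x) predn (f x))).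
  by move=> x; rewrite iter_predn.
apply: (computable_iter (h := fun _ => predn)) => //.
by apply/computable_predn/computable_snd/computable_id.
Qed.

End ComputableNat.

Lemma computable_muln {X : Type} {eX : encodable X} (f g : X -> nat) :
  computable f -> computable g -> computable (fun x => f x * g x).
Proof.
move=> hf hg.
apply: (computable_ext (f := fun x => iter (f x) (addn (g x)) 0)).
  by move=> x; rewrite iter_addn addn0 mulnC.
apply: (computable_iter (h := fun x => addn (g x))) => //; first exact: computable_const.
apply: computable_addn; last exact/computable_snd/computable_id.
by apply: (computable_comp (f := fst) _ hg); apply/computable_fst/computable_id.
Qed.

Section ComputableEq.
Context {X : Type} {eX : encodable X}.

Lemma computable_expn (f g : X -> nat) :
  computable f -> computable g -> computable (fun x => f x ^ g x).
Proof.
move=> hf hg.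
apply: (computable_ext (f := fun x => iter (g x) (muln (f x)) 1)).
  by move=> x; rewrite iter_muln muln1.
apply: (computable_iter (h := fun x => muln (f x))) => //; first exact: computable_const.
apply: computable_muln; last exact/computable_snd/computable_id.
by apply: (computable_comp (f := fst) _ hf); apply/computable_fst/computable_id.
Qed.

Lemma computable_eq0 (f : X -> nat) :
  computable f -> computable (fun x => f x == 0).
Proof.
move=> hf; apply: (computable_enc (f := fun x => 1 - f x)).
  by move=> x /=; case: (f x).
by apply: computable_subn => //; apply: computable_const.
Qed.

Lemma computable_eq {Y : eqType} {eY : encodable Y} (f g : X -> Y) :
  computable f -> computable g -> computable (fun x => f x == g x).
Proof.
move=> hf hg; pose e := @enc Y eY; pose df x := e (f x) - e (g x) + (e (g x) - e (f x)).
apply: (computable_ext (f := fun x => df x == 0)) => [x|].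
  by rewrite /df addn_eq0 !subn_eq0 -eqn_leq; apply/eqP/eqP => [/(@enc_inj _ eY)|->].
by apply/computable_eq0/computable_addn; apply: computable_subn.
Qed.

Context {E : Type} {eE : encodable E}.

Lemma computable_cons (e : X -> E) (l : X -> seq E) :
  computable e -> computable l -> computable (fun x => e x :: l x).
Proof.
move=> he hl.
apply: (computable_enc (f := fun x => (enc (e x, l x)).+1)) => //.
by apply/computable_succn/(computable_enc (f := fun x => (e x, l x)))/computable_pair.
Qed.

Lemma computable_behead (l : X -> seq E) :
  computable l -> computable (fun x => behead (l x)).
Proof.
move=> hl.
apply: (computable_enc (f := fun x => unpair2 (enc (l x)).-1)) => [x|].
  by case: (l x) => [|e s] //; rewrite [LHS]npairK2.
apply: computable_recursive; first exact: recursive_unpair2 (recursive_nth _).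
by apply: computable_predn; apply: computable_enc hl.
Qed.

Lemma computable_nilp (l : X -> seq E) :
  computable l -> computable (fun x => nilp (l x)).
Proof.
move=> hl.
apply: (computable_ext (f := fun x => enc (l x) == 0)) => [x|].
  by case: (l x).
by apply: computable_eq0; apply: computable_enc hl.
Qed.

Lemma computable_head (l : X -> seq E) :
  computable l -> computable (fun x => head default (l x)).
Proof.
move=> hl.
apply: (computable_enc (f := fun x =>
  if nilp (l x) then enc (default : E) else unpair1 (enc (l x)).-1)) => [x|].
  by case: (l x) => [|e s] //; rewrite [LHS]npairK1.
apply: computable_if; [exact: computable_nilp|exact: computable_const|].
apply: computable_recursive; first exact: recursive_unpair1 (recursive_nth _).
by apply: computable_predn; apply: computable_enc hl.
Qed.
End ComputableEq.

Lemma computable_foldl {X E A : Type} {eX : encodable X} {eE : encodable E}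
    {eA : encodable A} (h : X -> A -> E -> A) (a : X -> A) (l : X -> seq E) :
  computable (fun p => h p.1 p.2.1 p.2.2) -> computable a -> computable l ->
  computable (fun x => foldl (h x) (a x) (l x)).
Proof.
move=> hh ha hl.
pose step x (s : seq E * A) :=
  if nilp s.1 then s else (behead s.1, h x s.2 (head (@default E eE) s.1)).
(* The code of a list is at least its length and is available at once as a number, so it serves as
   iteration count; surplus rounds do nothing, the remaining list being empty. *)
apply: (computable_ext (f := fun x => (iter (enc (l x)) (step x) (l x, a x)).2)).
  move=> x; have iterE n s b : size s <= n ->
      (iter n (step x) (s, b)).2 = foldl (h x) b s.
    elim: n s b => [|n IH] [|e s] b //; last by move=> ss; rewrite iterSr IH.
    by rewrite iterSr IH.
  apply: iterE; elim: (l x) => // e s IH; apply: leq_ltn_trans IH _.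
  by rewrite [X in _ < X](_ : _ = (npair (enc e) (enc s)).+1) // ltnS npairE leq_addl.
apply: computable_snd; apply: computable_iter.
- exact: computable_enc hl.
- exact: computable_pair.
have p1 : computable (fun p : X * (seq E * A) => p.2.1).
  by apply/computable_fst/computable_snd/computable_id.
apply: computable_if; first exact: computable_nilp.
  exact/computable_snd/computable_id.
apply: computable_pair; first exact: computable_behead.
apply: (computable_comp (f := fun p : X * (seq E * A) =>
  (p.1, (p.2.2, head default p.2.1))) _ hh).
apply: computable_pair; first exact/computable_fst/computable_id.
apply: computable_pair; first exact/computable_snd/computable_snd/computable_id.
exact: computable_head.
Qed.

(* The hooks are redefined each time more functions are known to be computable. *)
Ltac comp_hook := fail.
Ltac comp_word_hook := fail.
Ltac comp_dfa_hook := fail.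

(** Goals are decomposed along the head symbol of the body; the last case expands a function that is
    not written as an abstraction. *)
Ltac comp_step :=
  cbv beta;
  lazymatch goal with
  | |- computable (fun _ => ?c) => exact: computable_const
  | |- computable (fun x => x) => exact: computable_id
  | |- computable (fun x => fst _) => apply: computable_fst
  | |- computable (fun x => snd _) => apply: computable_snd
  | |- computable (fun x => pair _ _) => apply: computable_pair
  | |- computable (fun x => if _ then _ else _) => apply: computable_if
  | |- computable (fun x => andb _ _) => apply: computable_andb
  | |- computable (fun x => orb _ _) => apply: computable_orb
  | |- computable (fun x => implb _ _) => apply: computable_implyb
  | |- computable (fun x => addn _ _) => apply: computable_addn
  | |- computable (fun x => subn _ _) => apply: computable_subn
  | |- computable (fun x => muln _ _) => apply: computable_muln
  | |- computable (fun x => expn _ _) => apply: computable_expn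
  | |- computable (fun x => S _) => apply: computable_succn
  | |- computable (fun x => predn _) => apply: computable_predn
  | |- computable (fun x => cons _ _) => apply: computable_cons
  | |- computable (fun x => behead _) => apply: computable_behead
  | |- computable (fun x => nilp _) => apply: computable_nilp
  | |- computable (fun x => head default _) => apply: computable_head
  | |- computable (fun x => eq_op _ _) => apply: computable_eq
  | |- computable (fun x => foldl _ _ _) => apply: computable_foldl
  | |- computable (fun x => iter _ _ _) => apply: computable_iter
  | |- computable (fun _ => _) => comp_hook
  | |- @computable ?X ?Y ?eX ?eY ?f => change (@computable X Y eX eY (fun x => f x))
  end.

Ltac comp := repeat first [ assumption | comp_step ].

(** * Computable operations on sequences *)

Section ComputableSeq.
Context {X : Type} {eX : encodable X}.
Context {E : Type} {eE : encodable E}.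

Lemma computable_rev (l : X -> seq E) :
  computable l -> computable (fun x => rev (l x)).
Proof.
move=> hl.
apply: (computable_ext (f := fun x => foldl (fun s e => e :: s) [::] (l x))).
  by move=> x; rewrite -(revK (l x)) foldl_rev revK; elim: (rev _) => //= e s ->.
by comp.
Qed.
End ComputableSeq.

Section ComputableSeqFun.
Context {X : Type} {eX : encodable X}.
Context {E : Type} {eE : encodable E} {F : Type} {eF : encodable F}.

Lemma foldl_cons (s t : seq E) : foldl (fun r e => e :: r) t s = catrev s t.
Proof. by elim: s t => //= e s IH t; rewrite IH. Qed.

Lemma computable_cat (s t : X -> seq E) :
  computable s -> computable t -> computable (fun x => s x ++ t x).
Proof.
move=> hs ht; have hr := computable_rev hs.
apply: (computable_ext (f := fun x => foldl (fun r e => e :: r) (t x) (rev (s x)))).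
  by move=> x; rewrite foldl_cons catrevE revK.
by comp.
Qed.

Lemma computable_size (s : X -> seq E) :
  computable s -> computable (fun x => size (s x)).
Proof.
move=> hs; apply: (computable_ext (f := fun x => foldl (fun k _ => k.+1) 0 (s x))).
  move=> x; rewrite -[RHS]addn0; elim: (s x) 0 => //= e r IH k.
  by rewrite IH addnS addSn.
by comp.
Qed.

(** Under [foldl] the context is the triple of parameter, accumulator and element; this lets a
    function of parameter and element ignore the accumulator. *)
Lemma computable_env2 {A G : Type} {eA : encodable A} {eG : encodable G}
    (h : X -> A -> G) :
  computable (fun p => h p.1 p.2) ->
  forall Z (eZ : encodable Z), computable (fun q : X * (Z * A) => h q.1 q.2.2).
Proof.
move=> hh Z eZ.
by apply: (computable_comp (f := fun q : X * (Z * A) => (q.1, q.2.2)) _ hh); comp.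
Qed.

Lemma computable_map (h : X -> E -> F) (s : X -> seq E) :
  computable (fun p => h p.1 p.2) -> computable s ->
  computable (fun x => map (h x) (s x)).
Proof.
move=> hh hs; have hh' := computable_env2 hh.
apply: (computable_ext (f := fun x =>
  rev (foldl (fun r e => h x e :: r) [::] (s x)))).
  by move=> x; rewrite -(revK (s x)) foldl_rev map_rev.
by apply: computable_rev; comp; apply: hh'.
Qed.

Lemma computable_filter (p : X -> E -> bool) (s : X -> seq E) :
  computable (fun q => p q.1 q.2) -> computable s ->
  computable (fun x => filter (p x) (s x)).
Proof.
move=> hp hs; have hp' := computable_env2 hp.
apply: (computable_ext (f := fun x =>
  rev (foldl (fun r e => if p x e then e :: r else r) [::] (s x)))).
  by move=> x; rewrite -(revK (s x)) foldl_rev filter_rev.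
by apply: computable_rev; comp; apply: hp'.
Qed.

Lemma computable_all (p : X -> E -> bool) (s : X -> seq E) :
  computable (fun q => p q.1 q.2) -> computable s ->
  computable (fun x => all (p x) (s x)).
Proof.
move=> hp hs; have hp' := computable_env2 hp.
apply: (computable_ext (f := fun x => foldl (fun r e => p x e && r) true (s x))).
  move=> x; rewrite -(revK (s x)) foldl_rev all_rev.
  by elim: (rev (s x)) => //= e r ->.
by comp; apply: hp'.
Qed.

Lemma computable_has (p : X -> E -> bool) (s : X -> seq E) :
  computable (fun q => p q.1 q.2) -> computable s ->
  computable (fun x => has (p x) (s x)).
Proof.
move=> hp hs; have hp' := computable_env2 hp.
apply: (computable_ext (f := fun x => foldl (fun r e => p x e || r) false (s x))).
  move=> x; rewrite -(revK (s x)) foldl_rev has_rev.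
  by elim: (rev (s x)) => //= e r ->.
by comp; apply: hp'.
Qed.
End ComputableSeqFun.

Lemma computable_flatten {X E : Type} {eX : encodable X} {eE : encodable E}
    (s : X -> seq (seq E)) :
  computable s -> computable (fun x => flatten (s x)).
Proof.
move=> hs; apply: (computable_ext (f := fun x => foldl cat [::] (s x))).
  move=> x; rewrite -[flatten _]cat0s; elim: (s x) [::] => [|t ss IH] r /=.
    by rewrite cats0.
  by rewrite IH catA.
comp; apply: computable_cat; comp.
Qed.

Lemma computable_mem {X : Type} {E : eqType} {eX : encodable X} {eE : encodable E}
    (e : X -> E) (s : X -> seq E) :
  computable e -> computable s -> computable (fun x => e x \in s x).
Proof.
move=> he hs; apply: (computable_ext (f := fun x => has (fun y => y == e x) (s x))).
  by move=> x; rewrite -has_pred1; apply: eq_has.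
apply: computable_has => //; comp.
by apply: (computable_comp (f := fst) _ he); comp.
Qed.

Lemma computable_iota {X : Type} {eX : encodable X} (m n : X -> nat) :
  computable m -> computable n -> computable (fun x => iota (m x) (n x)).
Proof.
(* The iterated function does not see the round number; the length of the list built so far supplies
   it. *)
move=> hm hn; apply: (computable_ext (f := fun x =>
  iter (n x) (fun s => s ++ [:: m x + size s]) [::])).
  move=> x; set F := fun s => _.
  have : size (iter (n x) F [::]) = n x /\ iter (n x) F [::] = iota (m x) (n x).
    elim: (n x) => // k [_ e]; rewrite iterS e /F size_cat !size_iota addn1; split=> //.
    by rewrite -[k.+1]addn1 iotaD.
  by case.
comp; apply: computable_cat; comp.
  by apply: (computable_comp (f := fst) _ hm); comp.
by apply: computable_size; comp.
Qed.

Ltac comp_hook ::=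
  lazymatch goal with
  | |- computable (fun x => rev _) => apply: computable_rev
  | |- computable (fun x => cat _ _) => apply: computable_cat
  | |- computable (fun x => size _) => apply: computable_size
  | |- computable (fun x => map _ _) => apply: computable_map
  | |- computable (fun x => filter _ _) => apply: computable_filter
  | |- computable (fun x => all _ _) => apply: computable_all
  | |- computable (fun x => has _ _) => apply: computable_has
  | |- computable (fun x => flatten _) => apply: computable_flatten
  | |- computable (fun x => iota _ _) => apply: computable_iota
  | |- computable (fun x => in_mem _ _) => apply: computable_mem
  | |- _ => comp_word_hook
  end.


(** * The game and the profiles of words *)

(** For an input word [u] and an output word [v], the only synchronization word of the shape
    required of automatic relations that represents the pair. *)
Fixpoint interleave (u v : seq nat) : seq nat :=
  match u, v with
  | a :: u', b :: v' => a :: b :: interleave u' v'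
  | [::], _ => v
  | _, [::] => u
  end.

Lemma interleave0s v : interleave [::] v = v. Proof. by []. Qed.

Lemma interleaves0 u : interleave u [::] = u. Proof. by case: u. Qed.

Lemma interleave_cat u1 u2 v1 v2 : size u1 = size v1 ->
  interleave (u1 ++ u2) (v1 ++ v2) = interleave u1 v1 ++ interleave u2 v2.
Proof. by elim: u1 v1 => [|a u IH] [|b v] //= [] /IH ->. Qed.

Lemma interleave_catl u1 u2 v : size v <= size u1 ->
  interleave (u1 ++ u2) v = interleave u1 v ++ u2.
Proof.
by elim: u1 v => [|a u IH] [|b v] //=; rewrite ?interleaves0 // ltnS => /IH ->.
Qed.

Lemma interleave_catr u v1 v2 : size u = size v1 ->
  interleave u (v1 ++ v2) = interleave u v1 ++ v2.
Proof. by move=> e; rewrite -{1}[u]cats0 interleave_cat. Qed.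

Fixpoint words (lo n k : nat) : seq (seq nat) :=
  if k is k'.+1 then
    flatten [seq [seq a :: w | w <- words lo n k'] | a <- iota lo n]
  else [:: [::]].

Definition words_upto lo n k :=
  locked (flatten [seq words lo n i | i <- iota 0 k.+1]).

Lemma mem_words lo n k w :
  (w \in words lo n k) = (size w == k) && all (fun a => lo <= a < lo + n) w.
Proof.
elim: k w => [|k IH] w /=; first by rewrite inE; case: w.
apply/flatten_mapP/idP => [[a ha /mapP[w' hw' ->]] /=|].
  by move: ha hw'; rewrite mem_iota IH => -> /andP[/eqP-> ->]; rewrite eqxx.
case: w => [|a w] //= /and3P[hs ha hw]; exists a; first by rewrite mem_iota.
by apply/map_f; rewrite IH; case/eqP: hs => ->; rewrite eqxx.
Qed.

Lemma mem_words_upto lo n k w : (w \in words_upto lo n k) =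
  (size w <= k) && all (fun a => lo <= a < lo + n) w.
Proof.
rewrite /words_upto -lock; apply/flatten_mapP/andP => [[i]|[h1 h2]].
  by rewrite mem_iota mem_words => /andP[_ h] /andP[/eqP-> ->].
by exists (size w); rewrite ?mem_iota // mem_words eqxx.
Qed.

Section Game.
Variables (S : Type) (step : S -> nat -> S) (acc : S -> bool) (ns ng d : nat).

Definition dfa_run := foldl step.
Local Notation run := dfa_run.

(* [domb s w]: some output completes [w] from state [s].  [finb s w]: outputs of
   length at most [2 * d] suffice for all inputs that extend [w].  [keepb s x z y]:
   writing [z] against [x], with lookahead [y], keeps every extension in the
   domain completable.  The bounds on the words are those that make these
   booleans exact, see [dombP], [finbP] and [keepbP]. *)
Definition domb s w :=
  has (fun v => acc (run s (interleave w v))) (words_upto ns ng (size w + d)).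

Definition finb s w :=
  all (fun u => domb s (w ++ u) ==>
      has (fun v => acc (run s (interleave (w ++ u) v))) (words_upto ns ng (2 * d)))
    (words_upto 0 ns d).

Definition keepb s x z y :=
  all (fun u => domb s (x ++ y ++ u) ==> domb (run s (interleave x z)) (y ++ u))
    (words_upto 0 ns d).

(** A safety condition: [W] is a post-fixpoint of a monotone operator, and a play may go on forever
    without the claim [finb] being made. *)
Definition winning (W : S -> seq nat -> Prop) :=
  forall s x, x \in words 0 ns d -> W s x -> forall y, y \in words 0 ns d ->
    finb s (x ++ y) \/
    exists2 z, z \in words ns ng d & keepb s x z y /\ W (run s (interleave x z)) y.

End Game.

(** * Profiles of words: exchange, pumping and shortening *)

Section Profiles.
Variables (Q : finType) (step : Q -> nat -> Q) (acc : pred Q) (ns ng : nat).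
Local Notation run := (dfa_run step).
Local Notation sigma := (all (isSig ns)).
Local Notation gamma := (all (isGam ns ng)).

Local Notation act := {ffun Q -> Q}.
Local Notation profile := ({set act} * {set act} * act)%type.

Definition action_step (f : act) a : act := [ffun q => step (f q) a].

Definition action (w : seq nat) : act := [ffun q => run q w].

(* [profile_of x] records the actions of [interleave x z] for the output words
   [z] with [size z = size x], resp. [size z <= size x], and of [x] itself.  It
   is computed letter by letter, hence is a right congruence of finite index. *)
Definition profile_step (p : profile) a : profile :=
  let F := [set action_step (action_step fi.1 a) (ns + fi.2) |
             fi : act * 'I_ng in setX p.1.1 [set: 'I_ng]] in
  (F, F :|: [set action_step f a | f in p.1.2], action_step p.2 a).

Definition profile_of (x : seq nat) : profile :=
  foldl profile_step ([set action [::]], [set action [::]], action [::]) x.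

Lemma run_cat q u v : run q (u ++ v) = run (run q u) v.
Proof. exact: foldl_cat. Qed.

Lemma action_rcons w a : action (rcons w a) = action_step (action w) a.
Proof. by apply/ffunP => q; rewrite !ffunE /dfa_run foldl_rcons. Qed.

Lemma profile_cat x y y' : profile_of x = profile_of y ->
  profile_of (x ++ y') = profile_of (y ++ y').
Proof. by rewrite /profile_of !foldl_cat => ->. Qed.

Lemma profile_action x : (profile_of x).2 = action x.
Proof.
elim/last_ind: x => //= x a IH.
by rewrite /profile_of foldl_rcons /= -/(profile_of x) IH action_rcons.
Qed.

Lemma profile_full x f : reflect
  (exists z, [/\ size z = size x, gamma z & f = action (interleave x z)])
  (f \in (profile_of x).1.1).
Proof.
elim/last_ind: x f => [|x a IH] f.
  rewrite inE; apply: (iffP eqP) => [->|[[|b z] [//= _ _ ->]]] //.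
  by exists [::].
rewrite /profile_of foldl_rcons -/(profile_of x) /=.
apply: (iffP imsetP) => [[[g i]]|[z []]].
  rewrite inE /= => /andP[/IH[z [hs hz ->]] _] ->; exists (rcons z (ns + i)).
  rewrite !size_rcons hs all_rcons hz -!cats1 interleave_cat //=; split=> //.
    by rewrite /isGam leq_addr ltn_add2l ltn_ord.
  by rewrite -cat_rcons cats1 !action_rcons.
case/lastP: z => [|z b]; rewrite !size_rcons // => -[hs].
rewrite all_rcons => /andP[/andP[b1 b2] hz] ->.
have hb : b - ns < ng by lia.
exists (action (interleave x z), Ordinal hb).
  by rewrite inE in_setT andbT; apply/IH; exists z.
by rewrite /= subnKC // -!cats1 interleave_cat //= -cat_rcons cats1 !action_rcons.
Qed.

Lemma profile_short x f : reflect
  (exists z, [/\ size z <= size x, gamma z & f = action (interleave x z)])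
  (f \in (profile_of x).1.2).
Proof.
elim/last_ind: x f => [|x a IH] f.
  rewrite inE; apply: (iffP eqP) => [->|[[|b z] [//= _ _ ->]]] //.
  by exists [::].
rewrite (_ : (profile_of (rcons x a)).1.2 = (profile_of (rcons x a)).1.1 :|:
  [set action_step g a | g in (profile_of x).1.2]); last first.
  by rewrite /profile_of foldl_rcons.
apply: (iffP setUP) => [[/profile_full[z [hs hz ->]]|/imsetP[g]]|[z [hs hz ->]]].
- by exists z; rewrite hs.
- move=> /IH[z [hs hz ->]] ->; exists z; rewrite size_rcons hz (leq_trans hs) //.
  by split=> //; rewrite -[rcons x a]cats1 interleave_catl // cats1 action_rcons.
- move: hs; rewrite leq_eqVlt => /orP[/eqP hs|].
    by left; apply/profile_full; exists z.
  rewrite size_rcons ltnS => hs; right; apply/imsetP.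
  exists (action (interleave x z)); first by apply/IH; exists z.
  by rewrite -cats1 interleave_catl // cats1 action_rcons.
Qed.

Lemma same_action x y q : profile_of x = profile_of y -> run q x = run q y.
Proof.
move=> /(congr1 snd); rewrite !profile_action => /ffunP/(_ q).
by rewrite !ffunE.
Qed.

(** The exchange principle behind pumping: since the action of [interleave x z] belongs to the
    profile, an output written against [x] has a counterpart against [y] that no state can tell
    apart. *)
Lemma same_full x y z : profile_of x = profile_of y ->
  size z = size x -> gamma z ->
  exists z', [/\ size z' = size y, gamma z' &
    forall q, run q (interleave y z') = run q (interleave x z)].
Proof.
move=> e hs hz; have : action (interleave x z) \in (profile_of x).1.1.
  by apply/profile_full; exists z.
rewrite e => /profile_full[z' [hs' hz' /ffunP ea]]; exists z'; split=> // q.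
by have := ea q; rewrite !ffunE.
Qed.

Lemma same_short x y z : profile_of x = profile_of y ->
  size z <= size x -> gamma z ->
  exists z', [/\ size z' <= size y, gamma z' &
    forall q, run q (interleave y z') = run q (interleave x z)].
Proof.
move=> e hs hz; have : action (interleave x z) \in (profile_of x).1.2.
  by apply/profile_short; exists z.
rewrite e => /profile_short[z' [hs' hz' /ffunP ea]]; exists z'; split=> // q.
by have := ea q; rewrite !ffunE.
Qed.

(** Pigeonhole: [w] has one more prefix than letters, hence more prefixes than there are
    profiles. *)
Lemma repeated_profile w : #|{: profile}| <= size w ->
  exists x y z, [/\ w = x ++ y ++ z, y != [::] & profile_of (x ++ y) = profile_of x].
Proof.
move=> hw; pose P (i : 'I_(size w).+1) := profile_of (take i w).
have /injectivePn[i [j ne e]] : ~~ injectiveb P.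
  apply/negP => /injectiveP hP; have := leq_card P hP.
  by rewrite card_ord => h; move: (leq_trans h hw); rewrite ltnn.
wlog lt_ij : i j ne e / i < j => [IH|].
  case: (ltngtP i j) => h; [exact: (IH i j)|apply: (IH j i) => //|].
    by rewrite eq_sym.
  by case/eqP: ne; apply: val_inj.
exists (take i w), (drop i (take j w)), (drop j w).
have eij : take i w ++ drop i (take j w) = take j w.
  by rewrite -(take_takel w (ltnW lt_ij)) cat_take_drop.
rewrite catA eij cat_take_drop; split=> //.
rewrite -size_eq0 size_drop size_takel ?subn_eq0 -?ltnNge //.
by rewrite -ltnS.
Qed.

(** Repeating the factor between two prefixes of equal profile preserves the profile, because it is
    a right congruence. The inclusion of letters keeps the pumped word over the input alphabet. *)
Lemma pump x N : #|{: profile}| <= size x ->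
  exists X, [/\ N <= size X, profile_of X = profile_of x & {subset X <= x}].
Proof.
(* The bound includes [size x] so that the word obtained is still long enough to be pumped again in
   the induction. *)
move=> hx; suff [X [hX e sX]] : exists X,
    [/\ N + size x <= size X, profile_of X = profile_of x & {subset X <= x}].
  by exists X; split=> //; apply: leq_trans hX; apply: leq_addr.
elim: N => [|N [X [hX e sX]]]; first by exists x; split=> [||y].
have [|a [b [c [eX b0 eab]]]] := @repeated_profile X.
  exact: leq_trans hx (leq_trans (leq_addl _ _) hX).
exists (a ++ b ++ b ++ c); split.
- move: hX; rewrite eX !size_cat; case: b b0 {eX eab} => //= *; lia.
- by rewrite -e eX (catA a) (profile_cat _ eab).
- move=> y; rewrite !mem_cat => h; apply: sX; rewrite eX !mem_cat.
  by case/or4P: h => ->; rewrite ?orbT.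
Qed.

Lemma shorten w : exists u,
  [/\ size u <= #|{: profile}|, profile_of u = profile_of w & {subset u <= w}].
Proof.
have [n] := ubnP (size w); elim: n w => // n IH w; rewrite ltnS => hn.
case: (leqP (size w) #|{: profile}|) => hw; first by exists w; split=> [||y].
have [a [b [c [ew b0 eab]]]] := repeated_profile (ltnW hw).
have [|u [hu eu su]] := IH (a ++ c).
  by move: hn; rewrite ew !size_cat; case: b b0 {ew eab} => //= *; lia.
exists u; split=> // [|y /su].
  by rewrite eu ew catA (profile_cat _ eab).
by rewrite ew !mem_cat => /orP[]->; rewrite ?orbT.
Qed.

Definition word_rel q u v := [&& sigma u, gamma v & acc (run q (interleave u v))].

Definition dom q w := exists2 v, gamma v & acc (run q (interleave w v)).

(** An output for [y ++ u] is cut where it passes the end of [y] and the end of [u]. The piece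
    against [y] and the overhang are kept, and the piece against [u] is exchanged through the
    profile. *)
Lemma dom_catr q y u u' : profile_of u = profile_of u' ->
  dom q (y ++ u) -> dom q (y ++ u').
Proof.
move=> e [v hv ha]; case: (leqP (size v) (size y)) => hs.
  exists v => //; move: ha; rewrite !interleave_catl // !run_cat.
  by rewrite (same_action _ e).
have sz : size y = size (take (size y) v) by rewrite size_takel // ltnW.
move: hv ha; rewrite -(cat_take_drop (size y) v) all_cat.
move: (take _ v) (drop _ v) sz => v1 v2 sz /andP[hv1 hv2].
rewrite interleave_cat // run_cat; set q' := run q _.
case: (leqP (size v2) (size u)) => hs2 ha.
  have [z [hz gz ez]] := same_short e hs2 hv2.
  by exists (v1 ++ z); rewrite ?all_cat ?hv1 // interleave_cat // run_cat ez.
have sz2 : size u = size (take (size u) v2) by rewrite size_takel // ltnW.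
move: hv2 ha; rewrite -(cat_take_drop (size u) v2) all_cat.
move: (take _ v2) (drop _ v2) sz2 => v3 v4 sz2 /andP[hv3 hv4].
rewrite interleave_catr // run_cat => ha.
have [z [hz gz ez]] := same_full e (esym sz2) hv3.
exists (v1 ++ z ++ v4); rewrite ?all_cat ?hv1 ?gz //.
by rewrite interleave_cat // interleave_catr // !run_cat ez.
Qed.

Lemma dom_catl q x y u : profile_of x = profile_of y ->
  dom q (x ++ u) -> dom q (y ++ u).
Proof.
by move=> e; rewrite -[x ++ u]cat0s -[y ++ u]cat0s; apply/dom_catr/profile_cat.
Qed.

Variable d : nat.
Hypothesis hd : #|{: profile}| <= d.

Lemma dombP q w : reflect (dom q w) (domb step acc ns ng d q w).
Proof.
apply: (iffP hasP) => [[v]|[v hv ha]].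
  by rewrite mem_words_upto => /andP[_ hv] ha; exists v.
case: (leqP (size v) (size w)) => hs.
  by exists v => //; rewrite mem_words_upto hv andbT (leq_trans hs) ?leq_addr.
have sz : size w = size (take (size w) v) by rewrite size_takel // ltnW.
move: hv ha; rewrite -(cat_take_drop (size w) v) all_cat.
move: (take _ v) (drop _ v) sz => v1 v2 sz /andP[hv1 hv2].
(* Here an output word is shortened: beyond the end of the input it is read alone, so only the
   action component of its profile counts. *)
have [z [hz ez sub]] := shorten v2.
rewrite interleave_catr // run_cat => ha; exists (v1 ++ z); last first.
  by rewrite interleave_catr // run_cat (same_action _ ez).
rewrite mem_words_upto size_cat sz leq_add2l (leq_trans hz) //=.
rewrite all_cat; apply/andP; split=> //.
by apply/allP => b /sub hb; apply: (allP hv2).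
Qed.

Lemma mem_sigma k w : (w \in words 0 ns k) = (size w == k) && sigma w.
Proof. exact: mem_words. Qed.

Lemma mem_gamma k w : (w \in words ns ng k) = (size w == k) && gamma w.
Proof. exact: mem_words. Qed.

Lemma shorten_sigma u : sigma u ->
  exists2 u', u' \in words_upto 0 ns d & profile_of u' = profile_of u.
Proof.
move=> hu; have [u' [h e sub]] := shorten u; exists u' => //.
rewrite mem_words_upto (leq_trans h) //=.
by apply/allP => a /sub ha; apply: (allP hu).
Qed.

(** An output of length at most [2 * d] ends inside [w], so [u] is read alone afterwards; acceptance
    and membership in the domain then depend only on the profile of [u], and a [u] of length at most
    [d] represents it. *)
Lemma finbP q w : size w = 2 * d -> reflect
  (forall u, sigma u -> dom q (w ++ u) -> exists v,
     [/\ size v <= 2 * d, gamma v & acc (run q (interleave w v ++ u))])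
  (finb step acc ns ng d q w).
Proof.
move=> sw; apply: (iffP allP) => [H u hu|H u].
  have [u' hu' e] := shorten_sigma hu.
  move=> /(dom_catr (esym e)) /dombP du; have := H _ hu'; rewrite du implyTb.
  case/hasP => v; rewrite mem_words_upto => /andP[hv gv].
  rewrite interleave_catl ?sw // run_cat (same_action _ e) => ha.
  by exists v; split=> //; rewrite run_cat.
rewrite mem_words_upto => /andP[_ su]; apply/implyP => /dombP/(H _ su)[v [hv gv ha]].
by apply/hasP; exists v; rewrite ?interleave_catl ?sw // mem_words_upto hv.
Qed.

Lemma keepbP q x z y : reflect
  (forall u, sigma u -> dom q (x ++ y ++ u) -> dom (run q (interleave x z)) (y ++ u))
  (keepb step acc ns ng d q x z y).
Proof.
apply: (iffP allP) => [H u hu|H u].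
  have [u' hu' e] := shorten_sigma hu.
  rewrite catA => /(dom_catr (esym e)); rewrite -catA => /dombP du.
  by have := H _ hu'; rewrite du implyTb => /dombP; apply: dom_catr.
by rewrite mem_words_upto => /andP[_ su]; apply/implyP => /dombP/(H _ su)/dombP.
Qed.

End Profiles.

Arguments dombP {Q step acc ns ng d} hd {q w}.
Arguments finbP {Q step acc ns ng d} hd {q w}.
Arguments keepbP {Q step acc ns ng d} hd {q x z y}.

(** * Finite shiftlag bounds the remaining output *)

Section Shifts.
Variables (ns ng : nat).

(** The number of shifts met while reading [t] after a letter whose membership in the input alphabet
    is [c]. *)
Fixpoint nshift (c : bool) (t : seq nat) : nat :=
  if t is a :: t' then (c (+) isSig ns a) + nshift (isSig ns a) t' else 0.

(** Positions are counted from 1, so [(size w1).+1] is the position of [b], and being a shift there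
    compares [b] with the first letter of [t]. *)
Lemma count_is_shift w1 b t r :
  count (is_shift ns (rcons w1 b ++ t ++ r)) (iota (size w1).+1 (size t)) =
  nshift (isSig ns b) t.
Proof.
elim: t w1 b => [|a t IH] w1 b //; rewrite [iota _ _]/= [LHS]/= [RHS]/= -cat_rcons.
rewrite -(IH (rcons w1 b)) size_rcons; congr (_ + _).
have e1 : nth 0 (rcons (rcons w1 b) a ++ t ++ r) (size w1) = b.
  by rewrite -!cats1 -!catA nth_cat ltnn subnn.
have e2 : nth 0 (rcons (rcons w1 b) a ++ t ++ r) (size w1).+1 = a.
  by rewrite -!cats1 -!catA nth_cat ltnNge leqnSn subSnn.
by rewrite /is_shift e1 e2 size_cat !size_rcons leq_addr.
Qed.

Lemma nshift_gam v t : all (isGam ns ng) v ->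
  nshift true (v ++ t) = (v != [::]) + nshift (v == [::]) t.
Proof.
have gamF a : isGam ns ng a -> isSig ns a = false.
  by case/andP=> h _; apply/negbTE; rewrite /isSig -leqNgt.
have H r : all (isGam ns ng) r -> nshift false (r ++ t) = nshift false t.
  by elim: r => //= a r IH /andP[/gamF -> /IH].
by case: v => //= a v /andP[/gamF -> /H ->].
Qed.

Lemma mem_take_filter_iota (p : pred nat) n a m i :
  i \in take n (filter p (iota a m)) ->
  [/\ a <= i < a + m & count p (iota a (i - a)) < n].
Proof.
move=> hi; have := mem_take hi.
rewrite mem_filter mem_iota => /andP[pi ii]; split=> //.
rewrite ltnNge; apply/negP => hn; move: hi.
have -> : m = (i - a) + (m - (i - a)) by lia.
rewrite iotaD filter_cat takel_cat ?size_filter // => /mem_take.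
by rewrite mem_filter mem_iota => /andP[_]; lia.
Qed.

(** * Shifts against output in the runs of a transducer *)

Section Transducer.
Variables (Q : finType) (T : sst Q).
Hypothesis wfT : sst_wf ns ng T.

Lemma sst_run_cat q u1 u2 : sst_run T q (u1 ++ u2) =
  if sst_run T q u1 is Some (p, s, o) then
    if sst_run T p u2 is Some (p', s', o') then Some (p', s ++ s', o ++ o')
    else None
  else None.
Proof.
elim: u1 q => [|a u1 IH] q /=; first by case: sst_run => [[[]]|].
case: st_delta => [[v q']|] //; rewrite IH; case: sst_run => [[[p s] o]|] //.
by case: sst_run => [[[p' s'] o']|] //; rewrite /= -!catA.
Qed.

Lemma sigNgam a : isSig ns a -> isGam ns ng a = false.
Proof. by rewrite /isGam /isSig ltnNge => /negbTE ->. Qed.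

Lemma count_sig_gam v : all (isGam ns ng) v -> count (isSig ns) v = 0.
Proof.
move=> /allP hv; apply/eqP; rewrite -leqn0 leqNgt -has_count -all_predC.
by apply/allP => a /hv /=; apply: contraL => /sigNgam ->.
Qed.

Lemma sst_run_sync q u p s o : all (isSig ns) u -> sst_run T q u = Some (p, s, o) ->
  [/\ count (isSig ns) s = size u, count (isGam ns ng) s = size o &
      all (isGam ns ng) o].
Proof.
elim: u q p s o => [|a u IH] q p s o /=; first by move=> _ [_ <- <-].
case/andP=> ha hu; case e: st_delta => [[v q']|] //.
case e': sst_run => [[[p' s'] o']|] // [_ <- <-].
have [h1 h2 h3] := IH _ _ _ _ hu e'; have gv := wfT.1 _ _ _ _ ha e.
rewrite /= !count_cat ha (sigNgam ha) h1 h2 (count_sig_gam gv) all_cat gv h3.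
by move: gv; rewrite all_count size_cat => /eqP ->; split; lia.
Qed.

Variable M : nat.
Hypothesis deltaM : forall q a v q',
  isSig ns a -> st_delta T q a = Some (v, q') -> size v <= M.

(** A nonempty block written by a transition directly follows an input letter, so it opens with a
    shift, and it has at most [M] letters. The extra unit pays for the final output, which may
    directly follow other output. *)
Lemma sync_prefix_bound u q p s o z c k : all (isSig ns) u -> size z <= M ->
  sst_run T q u = Some (p, s, o) ->
  count (isGam ns ng) (take k (s ++ z)) <= M * (nshift c (take k (s ++ z))).+1.
Proof.
have base r l c' : size r <= M ->
    count (isGam ns ng) (take l r) <= M * (nshift c' (take l r)).+1.
  move=> hr; apply: leq_trans (leq_pmulr _ _) => //.
  apply: leq_trans (count_size _ _) _; apply: leq_trans hr.
  by rewrite size_take_min geq_minr.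
move=> su hz; elim: u q p s o c k su => [|a u IH] q p s o c k /=.
  by move=> _ [_ <- _]; apply: base.
case/andP=> ha hu; case e: st_delta => [[v q']|] //.
case e': sst_run => [[[p' s'] o']|] // [_ <- _]; case: k => [|k] //=.
rewrite (sigNgam ha) add0n -catA ha.
have gv := wfT.1 _ _ _ _ ha e; have vM := deltaM ha e.
apply: (@leq_trans (M * (nshift true (take k (v ++ s' ++ z))).+1)); last first.
  by rewrite leq_mul2l ltnS leq_addl orbT.
case: (leqP k (size v)) => hk; first by rewrite takel_cat //; apply: base.
rewrite take_cat ltnNge (ltnW hk) /= nshift_gam // count_cat.
have := IH _ _ _ _ (v == [::]) (k - size v) hu e'.
set x := count _ (take _ _); set y := nshift _ _ => h.
have := count_size (isGam ns ng) v.
move=> h'; have cM := leq_trans h' vM.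
case: (v) h' cM => [|b v'] h' cM; first by rewrite add0n.
by rewrite add1n [M * _.+2]mulnS; apply: leq_add.
Qed.

Hypothesis finalM : forall q z, st_final T q = Some z -> size z <= M.

(* As long as fewer than [B.+1] shifts have occurred after [u1], at most
   [M * B.+1] letters have been written, so those shifts are still lagged. *)
Lemma tail_bound B u1 u2 p s1 o1 w o :
  (forall n, has_lagged_shifts ns ng w n -> n <= B) ->
  all (isSig ns) u1 -> all (isSig ns) u2 ->
  sst_run T (st_init T) u1 = Some (p, s1, o1) ->
  sst_accept T (u1 ++ u2) = Some (w, o) ->
  size o1 + B.+1 + M * B.+1 <= size u1 ->
  size o <= size o1 + M * B.+1.
Proof.
move=> hB su1 su2 e1; rewrite /sst_accept sst_run_cat e1.
case e2: sst_run => [[[p2 s2] o2]|] //; case ez: st_final => [z|] // [ew eo] hK.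
rewrite leqNgt; apply/negP => ho.
have [c1 c1' g1] := sst_run_sync su1 e1.
have [c2 c2' g2] := sst_run_sync su2 e2.
have gz := wfT.2 _ _ ez; have zM := finalM ez.
case/lastP: s1 e1 c1 c1' ew => [|w1 b] e1 c1 c1' ew; first by move: c1 => /=; lia.
have cz : count (isGam ns ng) z = size z by apply/eqP; rewrite -all_count.
have pref k := sync_prefix_bound (isSig ns b) k su2 zM e2.
have cnt k : k <= size (s2 ++ z) ->
    count (is_shift ns w) (iota (size w1).+1 k) = nshift (isSig ns b) (take k (s2 ++ z)).
  move=> hk; have := count_is_shift w1 b (take k (s2 ++ z)) (drop k (s2 ++ z)).
  by rewrite cat_take_drop size_takel // catA ew.
(* More than [M * B.+1] letters are written after [u1], which by the prefix bound requires more than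
   [B] shifts. *)
have big : B < count (is_shift ns w) (iota (size w1).+1 (size (s2 ++ z))).
  rewrite cnt // take_size -ltnS -(@ltn_pmul2l M); last first.
    case: M ho pref zM deltaM => // ho pref; have := pref (size (s2 ++ z)).
    by rewrite take_size count_cat c2' cz -eo !size_cat in ho *; lia.
  have := pref (size (s2 ++ z)); rewrite take_size count_cat c2' cz.
  by move: ho; rewrite -eo !size_cat; lia.
have : has_lagged_shifts ns ng w B.+1; last by move/hB; rewrite ltnn.
(* The shifts before the last letter [b] of the part produced by [u1] are skipped; the lagged ones
   are the next [B.+1], starting from the position of [b]. *)
pose A := filter (is_shift ns w) (iota 1 (size w1)).
have eS : shifts ns w = A ++ filter (is_shift ns w) (iota (size w1).+1 (size (s2 ++ z))).
  rewrite /shifts -filter_cat -add1n -iotaD -ew -catA !size_cat size_rcons.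
  by rewrite addSn.
exists (size A); rewrite eS drop_size_cat // size_cat size_filter leq_add2l; split=> //.
apply/allP => i /mem_take_filter_iota[/andP[i1 i2] hc].
have ti : take i w = rcons w1 b ++ take (i - (size w1).+1) (s2 ++ z).
  by rewrite -ew -catA take_cat size_rcons ltnNge i1.
rewrite /lag ti !count_cat c1 c1'.
move: hc; rewrite cnt; last by lia.
have := pref (i - (size w1).+1); set x := count _ (take _ _); set y := nshift _ _.
move=> h1 h2; have : M * y.+1 <= M * B.+1 by rewrite leq_mul2l h2 orbT.
rewrite /absdiff; move: hK h1; set MB := M * _; set My := M * _; lia.
Qed.

End Transducer.
End Shifts.

(** * Transducers and winning strategies *)

Section Transducers.
Variables (Q : finType) (step : Q -> nat -> Q) (acc : pred Q) (ns ng d : nat).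
Variable (q0 : Q).
Hypothesis hd : #|{: {set {ffun Q -> Q}} * {set {ffun Q -> Q}} * {ffun Q -> Q}}| <= d.

Local Notation run := (dfa_run step).
Local Notation sigma := (all (isSig ns)).
Local Notation gamma := (all (isGam ns ng)).
Local Notation dom := (dom step acc ns ng).
Local Notation word_rel := (word_rel step acc ns ng).
Local Notation profile_of := (profile_of step ns ng).

Lemma delay_gt0 : 0 < d.
Proof. by apply: leq_trans hd; apply/card_gt0P; exists (profile_of [::]). Qed.

Lemma same_short_cat x X y Y v : profile_of X = profile_of x ->
  profile_of Y = profile_of y -> size v <= size X + size Y -> gamma v ->
  exists v', [/\ size v' <= size x + size y, gamma v' &
    forall q, run q (interleave (x ++ y) v') = run q (interleave (X ++ Y) v)].
Proof.
move=> eX eY sv gv; case: (leqP (size v) (size X)) => hv.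
  have [v' [sv' gv' ev]] := same_short eX hv gv.
  exists v'; rewrite (leq_trans sv') ?leq_addr //; split=> // q.
  by rewrite !interleave_catl // !run_cat ev (same_action _ eY).
have s1 : size X = size (take (size X) v) by rewrite size_takel // ltnW.
move: gv sv; rewrite -(cat_take_drop (size X) v) all_cat size_cat -s1 leq_add2l.
move: (take _ v) (drop _ v) s1 => v1 v2 s1 /andP[g1 g2] sv2.
have [v1' [s1' g1' e1]] := same_full eX (esym s1) g1.
have [v2' [s2' g2' e2]] := same_short eY sv2 g2.
exists (v1' ++ v2'); rewrite size_cat s1' leq_add2l s2' all_cat g1' g2'.
by split=> // q; rewrite !interleave_cat // !run_cat e1 e2.
Qed.

Lemma dom_pump q x X y Y u : profile_of X = profile_of x ->
  profile_of Y = profile_of y -> dom q (x ++ y ++ u) -> dom q (X ++ Y ++ u).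
Proof.
move=> eX eY /(dom_catl (esym eX)).
by apply/dom_catr/profile_cat/esym.
Qed.

(** * From a transducer of finite shiftlag to a winning region *)

Section FromTransducer.
Variables (X : finType) (T : sst X).
Hypothesis wfT : sst_wf ns ng T.
Hypothesis lagT : finite_shiftlag ns ng (sst_sync ns T).
Hypothesis unifT : uniformizes ns T (word_rel q0).

(** The maximum ranges over states and the [ns] input letters: [st_delta] accepts every natural
    number, and only these transitions form a finite set. *)
Lemma output_bound : exists M,
  (forall p a v p', isSig ns a -> st_delta T p a = Some (v, p') -> size v <= M) /\
  (forall p z, st_final T p = Some z -> size z <= M).
Proof.
pose f (i : X * 'I_ns) := if st_delta T i.1 i.2 is Some (v, _) then size v else 0.
pose g p := if st_final T p is Some z then size z else 0.
exists (maxn (\max_i f i) (\max_p g p)); split=> [p a v p' ha e|p z e].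
  apply: leq_trans (leq_maxl _ _).
  by have := leq_bigmax (F := f) (p, Ordinal ha); rewrite /f /= e.
apply: leq_trans (leq_maxr _ _).
by have := leq_bigmax (F := g) p; rewrite /g e.
Qed.

Lemma accept_prefix u1 u2 p s o w o' :
  sst_run T (st_init T) u1 = Some (p, s, o) ->
  sst_accept T (u1 ++ u2) = Some (w, o') -> exists r, o' = o ++ r.
Proof.
rewrite /sst_accept sst_run_cat => ->; case: sst_run => [[[p2 s2] o2]|] //.
by case: st_final => // z [_ <-]; exists (o2 ++ z); rewrite catA.
Qed.

Lemma accept_of_dom u : sigma u -> dom q0 u -> exists w o,
  [/\ sst_accept T u = Some (w, o), gamma o & acc (run q0 (interleave u o))].
Proof.
move=> su [v gv av]; have [o eo] : exists o, sst_fun ns T u = Some o.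
  by apply/(unifT.1 u); exists v; apply/and3P.
have /and3P[_ go ao] := unifT.2 _ _ eo; move: eo; rewrite /sst_fun su.
by case: sst_accept => [[w o']|] //= -[eo']; exists w, o; rewrite eo'.
Qed.

(** The opponent's blocks are pumped and fed to the transducer. Either it has answered the older
    block completely, and the answer is carried back to length [d] by the profiles, or it lags so
    much that the remaining output is bounded. *)
Lemma winning_of_sst : exists W : Q -> seq nat -> Prop,
  winning step acc ns ng d W /\ forall x, x \in words 0 ns d -> W q0 x.
Proof.
have [M [dM fM]] := output_bound; have [B hB] := lagT.
have [C eC] : exists C, C = M * B.+1 by exists (M * B.+1).
(* The lead of the input demanded by [tail_bound]; a single unanswered pumped block provides it. *)
pose K := B.+1 + C.
have pumpS x : x \in words 0 ns d ->
    exists X, [/\ sigma X, K <= size X & profile_of X = profile_of x].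
  rewrite mem_sigma => /andP[/eqP sx gx].
  have [|Y [sY eY sub]] := @pump _ step ns ng x K; first by rewrite sx.
  by exists Y; split=> //; apply/allP => a /sub; apply: (allP gx).
(* [x] stands for a pumped block [Z] that the transducer reads after [U]. *)
exists (fun q x => exists U V Z,
  [/\ sigma U, sigma Z, gamma V & size U = size V] /\
  [/\ q = run q0 (interleave U V), profile_of Z = profile_of x, K <= size Z &
      forall p s o, sst_run T (st_init T) (U ++ Z) = Some (p, s, o) ->
        size U <= size o /\ take (size U) o = V]).
split; last first.
  move=> x /pumpS[Z [sZ KZ eZ]]; exists [::], [::], Z; split=> //; split=> // p s o _.
  by rewrite take0.
move=> q x hx [U [V [Z [[sU sZ gV sUV] [eq eZ KZ hZ]]]]] y hy.
have [Y [sY KY eY]] := pumpS _ hy.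
have [sx sy] : size x = d /\ size y = d.
  by move: hx hy; rewrite !mem_sigma => /andP[/eqP-> _] /andP[/eqP->].
have key u : sigma u -> dom q (x ++ y ++ u) -> exists w o,
    [/\ sst_accept T ((U ++ Z ++ Y) ++ u) = Some (w, o), gamma o &
        acc (run q0 (interleave (U ++ Z ++ Y ++ u) o))].
  move=> su /(dom_pump eZ eY)[v gv av].
  rewrite -!catA; apply: accept_of_dom; first by rewrite !all_cat sU sZ sY.
  by exists (V ++ v); rewrite ?all_cat ?gV // interleave_cat // run_cat -eq.
(* If the transducer is stuck, no continuation lies in the domain and the claim holds vacuously. *)
case er : (sst_run T (st_init T) (U ++ Z ++ Y)) => [[[p s] o]|]; last first.
  left; apply/(finbP hd); first by rewrite size_cat sx sy; lia.
  move=> u su; rewrite -catA => /(key _ su)[w [o []]].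
  by rewrite /sst_accept sst_run_cat er.
have [o1 eo1 so1] : exists2 o1, o = V ++ o1 & size o = size U + size o1.
  move: er; rewrite catA sst_run_cat.
  case er: sst_run => [[[p1 s1] o0]|] //; case: sst_run => [[[p2 s2] o2]|] //.
  move=> [_ _ <-]; have [h1 h2] := hZ _ _ _ er.
  exists (drop (size U) o0 ++ o2); last by rewrite !size_cat size_drop; lia.
  by rewrite -h2 catA cat_take_drop.
(* If [Z] is not yet covered, the lag is at least the length of [Y]. Then fewer than [size Z + C]
   letters are written against [Z] and beyond, so they fit inside [Z ++ Y] and are carried over to
   [x ++ y]. *)
case: (ltnP (size o1) (size Z)) => ho.
  left; apply/(finbP hd); first by rewrite size_cat sx sy; lia.
  move=> u su; rewrite -catA => /(key _ su)[w [o' [ea go aa]]].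
  have [r er'] := accept_prefix er ea.
  have sUZY : sigma (U ++ Z ++ Y) by rewrite !all_cat sU sZ sY.
  have wB n : has_lagged_shifts ns ng w n -> n <= B.
    apply: hB; exists ((U ++ Z ++ Y) ++ u); rewrite ea /=; split=> //.
    by rewrite all_cat sUZY.
  have := tail_bound wfT dM fM wB sUZY su er ea.
  rewrite so1 !size_cat -eC => /(_ ltac:(move: KY; clear -ho; rewrite /K; lia)) tb.
  have [v [sv gv ev]] : exists v', [/\ size v' <= size x + size y, gamma v' &
      forall q, run q (interleave (x ++ y) v') = run q (interleave (Z ++ Y) (o1 ++ r))].
    apply: same_short_cat => //; last by move: go; rewrite er' eo1 -catA all_cat => /andP[].
    by move: tb KY; rewrite er' eo1 !size_cat sUV /K; clear -ho; lia.
  exists v; split=> //; first by move: sv; rewrite sx sy; clear; lia.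
  rewrite run_cat ev -run_cat -interleave_catl; last first.
    by move: tb KY; rewrite er' eo1 !size_cat sUV /K; clear -ho; lia.
  by move: aa; rewrite er' eo1 -catA interleave_cat // run_cat -eq -catA.
(* The part [z1] of the output lies against [Z] and yields the move [z]; the surplus [o2] already
   lies against [Y] and is left to the next position. *)
right; pose z1 := take (size Z) o1; pose o2 := drop (size Z) o1.
have eo2 : o1 = z1 ++ o2 by rewrite cat_take_drop.
have sz1 : size Z = size z1 by rewrite size_takel.
have go1 : gamma (V ++ z1).
  have sUZY : sigma (U ++ Z ++ Y) by rewrite !all_cat sU sZ sY.
  have [_ _] := sst_run_sync wfT sUZY er.
  by rewrite eo1 eo2 catA all_cat => /andP[].
have gz1 : gamma z1 by move: go1; rewrite all_cat => /andP[].
have [z [sz gz ez]] := same_full eZ (esym sz1) gz1.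
exists z; first by rewrite mem_gamma sz sx eqxx.
rewrite ez; split.
  apply/(keepbP hd) => u su /(key _ su)[w [o' [ea go aa]]].
  have [r er'] := accept_prefix er ea.
  apply: (dom_catl eY); rewrite ez; exists (o2 ++ r).
    by move: go; rewrite er' eo1 eo2 -!catA !all_cat => /and4P[_ _ -> ->].
  move: aa; rewrite er' eo1 eo2 -!catA interleave_cat // run_cat -eq.
  by rewrite interleave_cat // run_cat.
exists (U ++ Z), (V ++ z1), Y; split.
  by rewrite all_cat sU sZ !size_cat sUV sz1.
rewrite interleave_cat // run_cat -eq; split=> // p' s' o'.
rewrite -catA er => -[_ _ <-].
rewrite so1 size_cat leq_add2l ho eo1 eo2 catA; split=> //.
by rewrite take_size_cat // !size_cat sUV sz1.
Qed.

End FromTransducer.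

(** * From a winning region to a transducer of finite shiftlag *)

Section ToTransducer.
Variable W : Q -> seq nat -> bool.
Hypothesis winW : winning step acc ns ng d W.
Hypothesis W0 : forall x, x \in words 0 ns d -> W q0 x.

Lemma mem_words_nil : [::] \in words_upto 0 ns (2 * d).
Proof. by rewrite mem_words_upto. Qed.

Definition lookahead := seq_sub (words_upto 0 ns (2 * d)).
Definition pending (w : lookahead) : seq nat := ssval w.
(** Words outside the range are sent to the empty word; see [lookahead_ofK] for the words on which
    it is faithful. *)
Definition lookahead_of (w : seq nat) : lookahead :=
  insubd (SeqSub mem_words_nil) w.

(* [(q, w, None)]: the output is as long as the input minus the pending input
   [w], and [q] is the state reached.  [(q, w, Some f)]: the output stays as it
   is until the end of the input, and [f] is the action of the input read
   after [w]. *)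
Definition lookahead_state := (Q * lookahead * option {ffun Q -> Q})%type.

(** Input is collected until two blocks are pending. Then either the claim [finb] is made and
    nothing is written until the end, or the first winning answer to the older block is written. *)
Definition lookahead_delta (st : lookahead_state) (a : nat) :
    option (seq nat * lookahead_state) :=
  let: (q, w, m) := st in
  if m is Some f then Some ([::], (q, w, Some (action_step step f a))) else
  let w' := rcons (pending w) a in
  if size w' < 2 * d then Some ([::], (q, lookahead_of w', None)) else
  if finb step acc ns ng d q w' then
    Some ([::], (q, lookahead_of w', Some (action step [::])))
  else
  let x := take d w' in let y := drop d w' in
  if [seq z <- words ns ng d | keepb step acc ns ng d q x z y &&
                               W (run q (interleave x z)) y] is z :: _
  then Some (z, (run q (interleave x z), lookahead_of y, None)) else None.

Definition lookahead_final (st : lookahead_state) : option (seq nat) :=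
  let: (q, w, m) := st in
  if m is Some f then
    ohead [seq v <- words_upto ns ng (2 * d) | acc (f (run q (interleave (pending w) v)))]
  else
    ohead [seq v <- words_upto ns ng (size (pending w) + d) |
            acc (run q (interleave (pending w) v))].

Definition lookahead_sst : sst lookahead_state :=
  SST (q0, lookahead_of [::], None) lookahead_delta lookahead_final.

Lemma ohead_filter (A : eqType) (p : pred A) s z :
  ohead (filter p s) = Some z -> z \in s /\ p z.
Proof.
case e: (filter p s) => [|z' r] //= [<-]; split.
  by have := mem_head z' r; rewrite -e mem_filter => /andP[].
by have := mem_head z' r; rewrite -e mem_filter => /andP[].
Qed.

Lemma ohead_filter_none (A : eqType) (p : pred A) s :
  ohead (filter p s) = None -> ~~ has p s.
Proof. by rewrite has_filter; case: filter. Qed.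

Lemma lookahead_wf : sst_wf ns ng lookahead_sst.
Proof.
split=> [[[q w] m] a v st' _ /=|[[q w] m] z /=].
  case: m => [f|]; first by case=> <-.
  case: ifP => _; first by case=> <-.
  case: ifP => _; first by case=> <-.
  case e: [seq _ <- _ | _] => [|z r] // [<- _].
  by have := mem_head z r; rewrite -e mem_filter mem_gamma => /andP[_ /andP[]].
by case: m => [f|] /ohead_filter[]; rewrite mem_words_upto => /andP[].
Qed.

Lemma lookahead_ofK w : sigma w -> size w <= 2 * d -> pending (lookahead_of w) = w.
Proof.
move=> sw hw; rewrite /lookahead_of /pending -[ssval _]/(val _) insubdK //.
by rewrite unfold_in mem_words_upto hw.
Qed.

(** Here [u1] is the input already answered by [o], and [u2] the input read after the claim. The lag
    is bounded only on [s1], which precedes [u2]. With fewer than [d] pending letters the game has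
    not begun, whence the initial state and an empty [u1]. *)
Definition lookahead_inv u (st : lookahead_state) s o :=
  let: (q, w', m) := st in let w := pending w' in
  exists u1 u2 s1, [/\ u = u1 ++ w ++ u2, size u1 = size o,
    q = run q0 (interleave u1 o),
    forall t, sigma t -> dom q0 (u ++ t) -> dom q (w ++ u2 ++ t) &
    [/\ s = s1 ++ u2,
     forall i, i <= size s1 -> lag ns ng s i <= 2 * d &
     if m is Some f then
       [/\ size w = 2 * d, f = action step u2 & finb step acc ns ng d q w]
     else [/\ u2 = [::], size w < 2 * d &
       if size w < d then q = q0 /\ u1 = [::] else W q (take d w)]]].

Lemma lag_cat s t i : i <= size s -> lag ns ng (s ++ t) i = lag ns ng s i.
Proof. by move=> hi; rewrite /lag takel_cat. Qed.

Lemma lag_rcons u q p s o a i : sigma u -> sst_run lookahead_sst q u = Some (p, s, o) ->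
  isSig ns a -> i = (size s).+1 -> lag ns ng (rcons s a) i = absdiff (size u).+1 (size o).
Proof.
move=> su e ha ->; have [c1 c2 _] := sst_run_sync lookahead_wf su e.
rewrite /lag -(size_rcons s a) take_size -cats1 !count_cat c1 c2 /= ha.
by rewrite (sigNgam _ ha) !addn0 addn1.
Qed.

Lemma lookahead_step u st s o a :
  sigma u -> isSig ns a ->
  sst_run lookahead_sst (st_init lookahead_sst) u = Some (st, s, o) ->
  lookahead_inv u st s o ->
  if lookahead_delta st a is Some (v, st') then
    lookahead_inv (rcons u a) st' (s ++ a :: v) (o ++ v)
  else forall t, sigma t -> ~ dom q0 (rcons u a ++ t).
Proof.
case: st => [[q w0] m] su ha er /=; set w := pending w0.
case=> u1 [u2 [s1 [eu so eq hdom [es hlag hm]]]].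
have d0 := delay_gt0.
have [sw gw] : size w <= 2 * d /\ sigma w.
  by have := ssvalP w0; rewrite mem_words_upto => /andP[].
case: m er hm => [f er [sw2 ef hf]|er [eu2 sw2 hW]].
  exists u1, (rcons u2 a), s1; rewrite cats0; split=> //.
  - by rewrite eu -!cats1 -!catA.
  - by move=> t st; rewrite !cat_rcons; apply: hdom; rewrite /= ha.
  split; last by rewrite ef -action_rcons.
    by rewrite es -cats1 -catA cats1.
  by move=> i hi; rewrite lag_cat ?hlag // es size_cat (leq_trans hi) ?leq_addr.
subst u2; rewrite cats0 in eu; rewrite cats0 in es; subst s1.
pose w' := rcons w a; rewrite -/w'.
have gw' : sigma w' by rewrite all_rcons ha.
have sw' : size w' = (size w).+1 by rewrite size_rcons.
have eu' : rcons u a = u1 ++ w' by rewrite eu rcons_cat.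
have hdom' t : sigma t -> dom q0 (rcons u a ++ t) -> dom q (w' ++ t).
  by move=> st; rewrite /w' !cat_rcons; apply: (hdom (a :: t)); rewrite /= ha.
have size_u : size u = size o + size w by rewrite eu size_cat so.
have hlag' i : i <= (size s).+1 -> lag ns ng (rcons s a) i <= 2 * d.
  rewrite leq_eqVlt => /orP[/eqP ei|]; last first.
    by rewrite ltnS => hi; rewrite -cats1 lag_cat ?hlag.
  by rewrite (lag_rcons su er ha ei) size_u /absdiff; lia.
case: ifP => hsz.
  rewrite /lookahead_inv (lookahead_ofK gw' (ltnW hsz)) !cats0 cats1.
  exists u1, [::], (rcons s a); rewrite !cats0; split=> //.
  split=> //; first by rewrite size_rcons.
  split=> //; case: ifP => hwd.
    by move: hW; rewrite (leq_trans _ hwd) // sw' leqnSn.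
  (* If the pending word has just reached length [d], the game begins, at a position of [W] by
     [W0]. *)
  case: ltnP hW => hwd' hW.
    have -> : take d w' = w'.
      by apply: take_oversize; move: hwd; rewrite sw' => /negbT; lia.
    by rewrite hW.1; apply: W0; rewrite mem_sigma gw' sw'; move: hwd; rewrite sw'; lia.
  by rewrite /w' -cats1 takel_cat.
have sw2' : size w' = 2 * d by move/negbT: hsz; rewrite sw'; lia.
case: ifP => hf.
  rewrite /lookahead_inv (lookahead_ofK gw') ?sw2' // !cats0 cats1.
  exists u1, [::], (rcons s a); rewrite !cats0; split=> //.
  by split=> //; first by rewrite size_rcons.
have hwd : d <= size w by lia.
rewrite ltnNge hwd /= in hW.
set x := take d w'; set y := drop d w'.
have exy : x ++ y = w' by rewrite cat_take_drop.
have sx : size x = d by rewrite size_takel // sw2' leq_pmull.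
have sy : size y = d by rewrite size_drop sw2'; clear; lia.
have [gx gy] : sigma x /\ sigma y by move: gw'; rewrite -exy all_cat => /andP.
have hx : x \in words 0 ns d by rewrite mem_sigma sx eqxx.
have hy : y \in words 0 ns d by rewrite mem_sigma sy eqxx.
have Wx : W q x by move: hW; rewrite /x /w' -cats1 takel_cat.
have [|[z hz [kz Wz]]] := winW hx Wx hy; first by rewrite exy hf.
case e: [seq _ <- _ | _] => [|z' r].
  have : z \in [::] by rewrite -e mem_filter kz Wz.
  by [].
have : z' \in [seq z <- words ns ng d | keepb step acc ns ng d q x z y &&
    W (run q (interleave x z)) y] by rewrite e mem_head.
rewrite mem_filter mem_gamma => /andP[/andP[{}kz {}Wz] /andP[/eqP sz gz]].
rewrite /lookahead_inv (lookahead_ofK gy); last by rewrite sy leq_pmull.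
exists (u1 ++ x), [::], (s ++ a :: z'); rewrite !cats0; split.
- by rewrite eu' -catA exy.
- by rewrite !size_cat so sx sz.
- by rewrite interleave_cat // run_cat -eq.
- move=> t st /(hdom' _ st); rewrite -exy -catA.
  by apply: (keepbP hd kz).
split=> //; last first.
  by rewrite sy ltnn take_oversize ?sy //; split=> //; clear -d0; lia.
(* The input leads by [2 * d] when the answer starts, and each of its at most [d] letters reduces
   this lead by one. *)
move=> i hi; rewrite -cat_rcons; case: (leqP i (size s).+1) => hi'.
  by rewrite lag_cat ?size_rcons // hlag'.
have -> : i = size (rcons s a) + (i - (size s).+1) by rewrite size_rcons; clear -hi'; lia.
have hj : i - (size s).+1 <= d by move: hi; rewrite size_cat /= sz; clear; lia.
move: (i - _) hj => j hj.
have [c1 c2 _] := sst_run_sync lookahead_wf su er.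
rewrite /lag takeD take_size_cat // drop_size_cat // !count_cat -cats1 !count_cat c1 c2.
have gj : gamma (take j z') by apply/allP => b /mem_take; apply: (allP gz).
rewrite (count_sig_gam gj) /= ha (sigNgam _ ha) size_u.
move: gj; rewrite all_count size_takel ?sz // => /eqP ->.
by rewrite /absdiff; move: sw2' sw' hj; clear; lia.
Qed.

Lemma lookahead_run u : sigma u ->
  if sst_run lookahead_sst (st_init lookahead_sst) u is Some (st, s, o)
  then lookahead_inv u st s o else forall t, sigma t -> ~ dom q0 (u ++ t).
Proof.
have d0 := delay_gt0.
elim/last_ind: u => [|u a IH] su.
  rewrite /= lookahead_ofK //; exists [::], [::], [::]; split=> //.
  by split=> //; rewrite /= d0 muln_gt0 d0.
move: su; rewrite all_rcons => /andP[ha su]; have := IH su.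
rewrite -cats1 sst_run_cat; case er: sst_run => [[[st s] o]|]; last first.
  by move=> H t st; rewrite -catA; apply: H; rewrite /= ha.
move=> /(lookahead_step su ha er); rewrite /= cats1.
by case: lookahead_delta => [[v st']|] //; rewrite !cats0.
Qed.

(** The decomposition of [w] serves the shiftlag bound: after the part of bounded lag there is one
    block of input followed by one block of output. *)
Lemma lookahead_accept u : sigma u ->
  match sst_accept lookahead_sst u with
  | Some (w, o) => [/\ gamma o, acc (run q0 (interleave u o)) &
      exists s1 u2 z, [/\ w = s1 ++ u2 ++ z, sigma u2, gamma z &
        forall i, i <= size s1 -> lag ns ng w i <= 2 * d]]
  | None => ~ dom q0 u
  end.
Proof.
move=> su; have := lookahead_run su; rewrite /sst_accept.
case er: sst_run => [[[st s] o]|]; last by move/(_ [::] isT); rewrite cats0.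
have [_ _ go] := sst_run_sync lookahead_wf su er.
case: st er => [[q w0] m] er /=; set w := pending w0.
case=> u1 [u2 [s1 [eu so eq hdom [es hlag hm]]]].
have gz z : st_final lookahead_sst (q, w0, m) = Some z -> gamma z.
  exact: lookahead_wf.2.
have su2 : sigma u2 by move: su; rewrite eu !all_cat => /and3P[].
have hl i z : i <= size s1 -> lag ns ng (s ++ z) i <= 2 * d.
  by move=> hi; rewrite lag_cat ?hlag // es size_cat (leq_trans hi) ?leq_addr.
have hd0 : dom q0 u -> dom q (w ++ u2).
  by have := hdom [::] isT; rewrite !cats0.
case: m er hm gz => [f|] er hm gz /=; case ez: ohead => [z|].
- have gz' := gz _ ez; have [hz hzacc] := ohead_filter ez.
  have [sw ef _] := hm; rewrite all_cat go gz'; split=> //; last first.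
    by exists s1, u2, z; rewrite es -catA; split=> // i hi; rewrite catA -es hl.
  rewrite eu interleave_cat // run_cat -eq interleave_catl; last first.
    by move: hz; rewrite mem_words_upto sw => /andP[].
  by move: hzacc; rewrite ef /action ffunE run_cat.
- move=> /hd0 dq; have [sw ef /(finbP hd sw)/(_ _ su2 dq)[v [hv gv av]]] := hm.
  move/hasP: (ohead_filter_none ez); apply; exists v.
    by rewrite mem_words_upto hv.
  by rewrite ef /action ffunE -run_cat.
- have gz' := gz _ ez; have [hz hzacc] := ohead_filter ez.
  have [eu2 sw _] := hm; rewrite all_cat go gz'; split=> //; last first.
    by exists s1, u2, z; rewrite es -catA; split=> // i hi; rewrite catA -es hl.
  by rewrite eu eu2 cats0 interleave_cat // run_cat -eq.
- have [eu2 _ _] := hm; rewrite eu2 cats0 in hd0.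
  by move=> /hd0/(dombP hd); apply/negP/(ohead_filter_none ez).
Qed.

Lemma lookahead_unif : uniformizes ns lookahead_sst (word_rel q0).
Proof.
have H u v : sst_fun ns lookahead_sst u = Some v -> word_rel q0 u v.
  rewrite /sst_fun; case: ifP => // su; have := lookahead_accept su.
  case: sst_accept => [[w o]|] //= [go ao _] [<-].
  exact/and3P.
split=> // u; split=> [[v /and3P[su gv av]]|[v /H hv]]; last by exists v.
have := lookahead_accept su; rewrite /sst_fun su.
case: sst_accept => [[w o]|] /=; first by exists o.
by case; exists v.
Qed.

(** A shift of lag above [2 * d] lies after [s1], where the boundary between [u2] and the final
    output is the only candidate; so at most one such shift exists. *)
Lemma lookahead_shiftlag : finite_shiftlag ns ng (sst_sync ns lookahead_sst).
Proof.
exists (2 * d).+1 => w [u [su ew]] n [k [hk hn]]; rewrite leqNgt; apply/negP => nd.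
have := lookahead_accept su; move: ew.
case: sst_accept => [[w' o]|] //= [->] [_ _ [s1 [u2 [z [ew su2 gz hl]]]]].
set L := take n (drop k (shifts ns w)) in hn.
have sL : size L = n by rewrite size_takel // size_drop; lia.
have uL : uniq L by apply/take_uniq/drop_uniq/filter_uniq/iota_uniq.
have : {subset L <= [:: size s1 + size u2]}; last first.
  by move/(uniq_leq_size uL); rewrite sL /=; lia.
move=> i iL; have hi := allP hn _ iL.
have i1 : size s1 < i by rewrite ltnNge; apply/negP => /hl; lia.
have : is_shift ns w i.
  by have := mem_drop (mem_take iL); rewrite mem_filter => /andP[].
case/and3P => _ iw; rewrite inE ew.
have e j : size s1 <= j -> j < size w -> isSig ns (nth 0 w j) = (j - size s1 < size u2).
  move=> hj jw; rewrite ew nth_cat ltnNge hj /= nth_cat; case: ltnP => h.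
    by have /allP := su2; apply; apply: mem_nth.
  apply/negbTE; rewrite /isSig -leqNgt.
  have zj : nth 0 z (j - size s1 - size u2) \in z.
    have zj : j - size s1 - size u2 < size z.
      by move: jw h hj; rewrite ew !size_cat; clear; lia.
    exact: mem_nth.
  by have /andP[] := allP gz _ zj.
rewrite -ew e ?e; lia.
Qed.

Theorem sst_of_winning : exists (X : finType) (T : sst X),
  [/\ sst_wf ns ng T, finite_shiftlag ns ng (sst_sync ns T) &
      uniformizes ns T (word_rel q0)].
Proof.
exists lookahead_state, lookahead_sst; split.
- exact: lookahead_wf.
- exact: lookahead_shiftlag.
- exact: lookahead_unif.
Qed.

End ToTransducer.
End Transducers.

(** * The decision procedure *)

Section GreatestFixpoint.
Variables (S : eqType) (step : S -> nat -> S) (acc : S -> bool) (ns ng d : nat).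
Variables (states : seq S) (s0 : S).
Hypothesis s0_in : s0 \in states.
Hypothesis step_in : forall s a, s \in states -> step s a \in states.

Definition positions :=
  flatten [seq [seq (s, x) | x <- words 0 ns d] | s <- states].

Definition safe (L : seq (S * seq nat)) (p : S * seq nat) :=
  all (fun y => finb step acc ns ng d p.1 (p.2 ++ y) ||
      has (fun z => keepb step acc ns ng d p.1 p.2 z y &&
          ((dfa_run step p.1 (interleave p.2 z), y) \in L)) (words ns ng d))
    (words 0 ns d).

Definition restrict L := filter (safe L) L.

Definition winning_region := iter (size positions) restrict positions.

Definition solve := all (fun x => (s0, x) \in winning_region) (words 0 ns d).

(** A round that changes the list removes a position, so there are at most as many such rounds as
    positions. *)
Lemma restrict_fixpoint n L : size L <= n ->
  restrict (iter n restrict L) = iter n restrict L.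
Proof.
elim: n L => [|n IH] L hL; first by move: hL; case: L.
have [/all_filterP fL|nL] := boolP (all (safe L) L).
  by elim: n.+1 => //= m {1}->.
rewrite iterSr IH //; move: nL; rewrite all_count => nL.
have := count_size (safe L) L.
by rewrite /restrict size_filter leq_eqVlt (negbTE nL) => h; rewrite -ltnS (leq_trans h).
Qed.

Lemma winning_region_winning :
  winning step acc ns ng d (fun s x => (s, x) \in winning_region).
Proof.
move=> s x _; rewrite -{1}[winning_region]restrict_fixpoint // mem_filter.
case/andP=> /allP H _ y /H /orP[|/hasP[z hz /andP[kz Wz]]]; first by left.
by right; exists z.
Qed.

(** By induction on the rounds, no position of [W] is ever removed, so the computed region is the
    greatest one. *)
Lemma solve_complete (W : S -> seq nat -> Prop) : winning step acc ns ng d W ->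
  (forall x, x \in words 0 ns d -> W s0 x) -> solve.
Proof.
move=> winW W0; apply/allP => x hx.
have run_in s w : s \in states -> dfa_run step s w \in states.
  by elim: w s => //= a w IH s /(step_in a); apply: IH.
suff H n s y : s \in states -> y \in words 0 ns d -> W s y ->
    (s, y) \in iter n restrict positions by apply: H => //; apply: W0.
elim: n s y => [|n IH] s y hs hy Wsy /=.
  by apply/flatten_mapP; exists s => //; apply: map_f.
rewrite mem_filter IH // andbT; apply/allP => t ht; apply/orP.
have [|[z hz [kz Wz]]] := winW _ _ hy Wsy _ ht; [by left|right].
by apply/hasP; exists z; rewrite // kz IH //; apply: run_in.
Qed.

End GreatestFixpoint.

(** * Determinization and the explicit bound on profiles *)

Definition sublists (l : seq nat) : seq (seq nat) :=
  foldl (fun L x => L ++ [seq rcons s x | s <- L]) [:: [::]] l.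

Lemma mem_sublists s l : subseq s l -> s \in sublists l.
Proof.
elim/last_ind: l s => [|l x IH] s; first by rewrite subseq0 inE.
rewrite /sublists foldl_rcons -/(sublists l) mem_cat.
case/lastP: s => [_|s y]; first by rewrite IH ?sub0seq.
rewrite -subseq_rev !rev_rcons /=; case: eqP => [->|_].
  rewrite subseq_rev => /IH h; apply/orP; right.
  by apply/mapP; exists s.
by rewrite -rev_rcons subseq_rev => /IH ->.
Qed.

Lemma size_sublists l : size (sublists l) = 2 ^ size l.
Proof.
elim/last_ind: l => // l x IH.
rewrite /sublists foldl_rcons -/(sublists l) size_cat size_map IH size_rcons.
by rewrite expnS mul2n addnn.
Qed.

Definition accepting (A : nfa) (s : seq nat) := has (fun q => q \in nfin A) s.

(** The subset construction on lists: [nstep] returns a subsequence of the list of all targets, so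
    finitely many lists suffice although equal sets may occur as different lists. *)
Definition dfa_states (A : nfa) :=
  ninit A :: sublists [seq t.2 | t <- ntrans A].

Lemma nstep_in A s a : nstep A s a \in dfa_states A.
Proof.
by rewrite inE mem_sublists ?orbT //; apply/map_subseq/filter_subseq.
Qed.

(** A computable bound on the number of self-maps of the determinized states, which takes the place
    of the cardinality of a finite type. *)
Definition num_maps (A : nfa) :=
  (2 ^ size (ntrans A)).+1 ^ (2 ^ size (ntrans A)).+1.

Definition num_profiles (A : nfa) :=
  2 ^ num_maps A * 2 ^ num_maps A * num_maps A.

Section Determinize.
Variable A : nfa.
Local Notation ns := (nsig A).
Local Notation ng := (ngam A).

Definition dfa_state : finType := seq_sub (dfa_states A).
Definition dfa_val (q : dfa_state) : seq nat := ssval q.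
Definition dfa_step (q : dfa_state) a : dfa_state := SeqSub (nstep_in A (dfa_val q) a).
Definition dfa_init : dfa_state := SeqSub (mem_head (ninit A) _).
Definition dfa_acc (q : dfa_state) := accepting A (dfa_val q).

Lemma dfa_runE q w :
  dfa_val (dfa_run dfa_step q w) = dfa_run (nstep A) (dfa_val q) w.
Proof. by elim: w q => //= a w IH q; rewrite IH. Qed.

Lemma card_profiles :
  #|{: {set {ffun dfa_state -> dfa_state}} * {set {ffun dfa_state -> dfa_state}}
       * {ffun dfa_state -> dfa_state}}| <= num_profiles A.
Proof.
have hQ : #|{: dfa_state}| <= (2 ^ size (ntrans A)).+1.
  have := @uniq_leq_size _ [seq ssval q | q <- enum dfa_state] (dfa_states A).
  rewrite size_map -cardE /= size_sublists size_map; apply.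
    by rewrite map_inj_uniq ?enum_uniq //; apply: val_inj.
  by move=> s /mapP[q _ ->]; apply: ssvalP.
have hM : #|{ffun dfa_state -> dfa_state}| <= num_maps A.
  rewrite card_ffun /num_maps; have k0 : 0 < #|{: dfa_state}|.
    by apply/card_gt0P; exists dfa_init.
  by apply: leq_trans (leq_pexp2l k0 hQ) _; rewrite leq_exp2r.
have cardset (T : finType) : #|{: {set T}}| = 2 ^ #|T|.
  by rewrite -[LHS]cardsT -powersetT card_powerset cardsT.
rewrite !card_prod !cardset /num_profiles.
by rewrite !leq_mul // leq_exp2l.
Qed.

(** In an automatic presentation every accepted word has the prescribed shape, hence is the
    interleaving of its two projections. *)
Lemma word_relE u v : automatic_presentation A ->
  word_rel dfa_step dfa_acc ns ng dfa_init u v <-> relA A u v.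
Proof.
move=> autA; have accE w : dfa_acc (dfa_run dfa_step dfa_init w) = nacc A w.
  by rewrite /dfa_acc dfa_runE.
have sigK w : all (isSig ns) w -> proj_i ns w = w by move/all_filterP.
have gamK w : all (isGam ns ng) w -> proj_o ns ng w = w by move/all_filterP.
have sigN w : all (isSig ns) w -> proj_o ns ng w = [::].
  elim: w => //= a w IH /andP[ha /IH]; rewrite /proj_o /= => ->.
  by rewrite (sigNgam ng ha).
have gamN w : all (isGam ns ng) w -> proj_i ns w = [::].
  elim: w => //= a w IH /andP[ha /IH]; rewrite /proj_i /= => ->.
  by case: ifP => // /(sigNgam ng); rewrite ha.
split=> [/and3P[su gv]|[w [aw [<- <-]]]].
  rewrite accE => aw; exists (interleave u v); split=> //.
  elim: u v su gv {aw} => [|a u IH] [|b v].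
  - by [].
  - by move=> _ gv; rewrite interleave0s gamN // gamK.
  - by move=> su _; rewrite interleaves0 sigK // sigN.
  rewrite /=; case/andP=> ha su /andP[hb gv]; have [e1 e2] := IH v su gv.
  rewrite /proj_i /proj_o /= ha (sigNgam ng ha) hb -/(proj_i _ _) -/(proj_o _ _ _) e1 e2.
  by case: ifP => // /(sigNgam ng); rewrite hb.
apply/and3P; split; [exact: filter_all|exact: filter_all|].
suff -> : interleave (proj_i ns w) (proj_o ns ng w) = w by rewrite accE.
have [ps [r [-> s1 g2 hr]]] := autA _ aw.
elim: ps s1 g2 => [|[a b] ps IH] /=.
  case/orP: hr => hr _ _; first by rewrite sigN // sigK // interleaves0.
  by rewrite gamN // gamK.
case/andP=> ha s1 /andP[hb g2]; move: (IH s1 g2); set w' := _ ++ r => e.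
have hb' : isSig ns b = false by apply: contraTF hb => /(sigNgam ng) ->.
rewrite /proj_i /proj_o /= ha (sigNgam ng ha) hb hb' -/(proj_i _ _) -/(proj_o _ _ _) /=.
by rewrite e.
Qed.

Definition solvable :=
  solve (nstep A) (accepting A) ns ng (num_profiles A) (dfa_states A) (ninit A).

(** The procedure runs on bare lists of states, whereas profiles need a finite type; this and the
    next lemmas carry the tests across. *)
Lemma domb_val d q w : domb (nstep A) (accepting A) ns ng d (dfa_val q) w =
  domb dfa_step dfa_acc ns ng d q w.
Proof. by apply: eq_has => v; rewrite /dfa_acc dfa_runE. Qed.

Lemma finb_val d q w : finb (nstep A) (accepting A) ns ng d (dfa_val q) w =
  finb dfa_step dfa_acc ns ng d q w.
Proof.
apply: eq_all => u; rewrite domb_val; congr (_ ==> _).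
by apply: eq_has => v; rewrite /dfa_acc dfa_runE.
Qed.

Lemma keepb_val d q x z y :
  keepb (nstep A) (accepting A) ns ng d (dfa_val q) x z y =
  keepb dfa_step dfa_acc ns ng d q x z y.
Proof. by apply: eq_all => u; rewrite -dfa_runE !domb_val. Qed.

Lemma nstep_closed s a : s \in dfa_states A -> nstep A s a \in dfa_states A.
Proof. by move=> _; apply: nstep_in. Qed.

Lemma solvable_correct : automatic_presentation A ->
  has_finite_shiftlag_uniformizer A <-> solvable.
Proof.
move=> autA; have relE u v := word_relE u v autA.
have hd := card_profiles.
have ext (X : finType) (T : sst X) : uniformizes ns T (relA A) <->
    uniformizes ns T (word_rel dfa_step dfa_acc ns ng dfa_init).
  split=> -[h1 h2]; split=> [u|u v /h2/relE//].
    by rewrite -h1; split=> -[v /relE hv]; exists v.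
  by rewrite -h1; split=> -[v /relE hv]; exists v.
split=> [[X [T [wfT lagT /ext unifT]]]|sol].
  have [W [winW W0]] := winning_of_sst hd wfT lagT unifT.
  apply: (solve_complete (mem_head _ _) nstep_closed
    (W := fun s x => exists2 q, dfa_val q = s & W q x)) => [s x hx [q <- Wq] y hy|x /W0 Wx].
    have [|[z hz [kz Wz]]] := winW _ _ hx Wq _ hy; first by rewrite finb_val; left.
    right; exists z => //; rewrite keepb_val; split=> //.
    by eexists; last exact: Wz; rewrite dfa_runE.
  by exists dfa_init.
pose L := winning_region (nstep A) (accepting A) ns ng (num_profiles A) (dfa_states A).
pose W (q : dfa_state) x := (dfa_val q, x) \in L.
have winW : winning dfa_step dfa_acc ns ng (num_profiles A) W.
  move=> q x hx Wq y hy.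
  have [|[z hz [kz Wz]]] := winning_region_winning hx Wq hy.
    by rewrite finb_val; left.
  right; exists z => //; rewrite -keepb_val; split=> //.
  by rewrite /W dfa_runE.
have W0 x : x \in words 0 ns (num_profiles A) -> W dfa_init x by apply: (allP sol).
have [X [T [wfT lagT /ext unifT]]] := sst_of_winning hd winW W0.
by exists X, T.
Qed.

End Determinize.

(** * Computability of the decision procedure *)

(** Nested as in [encode_nfa], so that the generic code of the tuple is the prescribed code of the
    automaton. *)
Definition nfa_fields (A : nfa) :=
  (nsig A, (ngam A, (ntrans A, (ninit A, nfin A)))).

Lemma encode_nfaE A : encode_nfa A = enc (nfa_fields A).
Proof.
have e (l : seq nat) : enc_list l = enc l.
  by congr enc_list; elim: l => //= x l <-.
by rewrite /encode_nfa !(e (ninit A)) !(e (nfin A)).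
Qed.

Lemma encode_nfa_inj : injective encode_nfa.
Proof.
move=> [a b c d e] [a' b' c' d' e']; rewrite !encode_nfaE => h.
by have := enc_inj h; rewrite /nfa_fields /= => -[-> -> -> -> ->].
Qed.

#[export] Instance encodable_nfa : encodable nfa :=
  Encodable encode_nfa_inj (NFA 0 0 [::] [::] [::]).

Section Fields.
Context {X : Type} {eX : encodable X} (A : X -> nfa).
Hypothesis hA : computable A.

Lemma computable_nfa_fields : computable (fun x => nfa_fields (A x)).
Proof. by apply: computable_enc hA => x; rewrite -encode_nfaE. Qed.
Let h := computable_nfa_fields.

Lemma computable_nsig : computable (fun x => nsig (A x)).
Proof. exact: computable_fst h. Qed.
Lemma computable_ngam : computable (fun x => ngam (A x)).
Proof. exact: (computable_fst (computable_snd h)). Qed.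
Lemma computable_ntrans : computable (fun x => ntrans (A x)).
Proof. exact: (computable_fst (computable_snd (computable_snd h))). Qed.
Lemma computable_ninit : computable (fun x => ninit (A x)).
Proof. exact: (computable_fst (computable_snd (computable_snd (computable_snd h)))). Qed.
Lemma computable_nfin : computable (fun x => nfin (A x)).
Proof. exact: (computable_snd (computable_snd (computable_snd (computable_snd h)))). Qed.
End Fields.

Lemma computable_rcons {X E : Type} {eX : encodable X} {eE : encodable E}
    (s : X -> seq E) (e : X -> E) :
  computable s -> computable e -> computable (fun x => rcons (s x) (e x)).
Proof.
move=> hs he; apply: (computable_ext (f := fun x => s x ++ [:: e x])).
  by move=> x; rewrite cats1.
by comp.
Qed.

Lemma computable_words {X : Type} {eX : encodable X} (lo n k : X -> nat) :
  computable lo -> computable n -> computable k ->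
  computable (fun x => words (lo x) (n x) (k x)).
Proof.
move=> hlo hn hk; pose grow (t : nat * nat) L :=
  flatten [seq [seq a :: w | w <- L] | a <- iota t.1 t.2].
(* The arguments are first the components of one tuple, where only projections occur; composition
   then restores arbitrary arguments. *)
have H : computable (fun t : nat * nat * nat => iter t.2 (grow t.1) [:: [::]]).
  by rewrite /grow; comp.
apply: (computable_ext (f := fun x => iter (k x) (grow (lo x, n x)) [:: [::]])).
  by move=> x; elim: (k x) => //= i ->.
by apply: (computable_comp (f := fun x => (lo x, n x, k x)) _ H); comp.
Qed.

Lemma computable_words_upto {X : Type} {eX : encodable X} (lo n k : X -> nat) :
  computable lo -> computable n -> computable k ->
  computable (fun x => words_upto (lo x) (n x) (k x)).
Proof.
move=> hlo hn hk.
have H : computable (fun t : nat * nat * nat =>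
    flatten [seq words t.1.1 t.1.2 i | i <- iota 0 t.2.+1]).
  by comp; apply: computable_words; comp.
apply: (computable_ext (f := fun x =>
    flatten [seq words (lo x) (n x) i | i <- iota 0 (k x).+1])).
  by move=> x; rewrite /words_upto -lock.
by apply: (computable_comp (f := fun x => (lo x, n x, k x)) _ H); comp.
Qed.

Lemma computable_interleave {X : Type} {eX : encodable X} (u v : X -> seq nat) :
  computable u -> computable v -> computable (fun x => interleave (u x) (v x)).
Proof.
(* The fold over [u] carries the word built so far and the unread rest of [v], which is appended at
   the end. *)
move=> hu hv; pose step (r : seq nat * seq nat) a :=
  if nilp r.2 then (r.1 ++ [:: a], r.2)
  else (r.1 ++ [:: a; head (@default nat encodable_nat) r.2], behead r.2).
pose F (t : seq nat * seq nat) := foldl step ([::], t.2) t.1.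
have H : computable F by rewrite /F /step; comp.
apply: (computable_ext (f := fun x => (F (u x, v x)).1 ++ (F (u x, v x)).2)).
  move=> x; rewrite /F /= -[RHS]cat0s.
  elim: (u x) [::] (v x) => [|a w IH] r [|b z] //=.
    by rewrite IH -catA interleaves0.
  by rewrite IH -catA.
have HF : computable (fun x => F (u x, v x)).
  by apply: (computable_comp (f := fun x => (u x, v x)) _ H); comp.
by comp.
Qed.

Ltac comp_word_hook ::=
  lazymatch goal with
  | |- computable (fun x => nsig _) => apply: computable_nsig
  | |- computable (fun x => ngam _) => apply: computable_ngam
  | |- computable (fun x => ntrans _) => apply: computable_ntrans
  | |- computable (fun x => ninit _) => apply: computable_ninit
  | |- computable (fun x => nfin _) => apply: computable_nfin
  | |- computable (fun x => rcons _ _) => apply: computable_rcons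
  | |- computable (fun x => words _ _ _) => apply: computable_words
  | |- computable (fun x => words_upto _ _ _) => apply: computable_words_upto
  | |- computable (fun x => interleave _ _) => apply: computable_interleave
  | |- _ => comp_dfa_hook
  end.

(** * The determinized automaton and the game tests as computable functions *)

Section Solver.
Context {X : Type} {eX : encodable X} (A : X -> nfa).
Hypothesis hA : computable A.

Lemma computable_run (s w : X -> seq nat) : computable s -> computable w ->
  computable (fun x => dfa_run (nstep (A x)) (s x) (w x)).
Proof.
move=> hs hw.
have H : computable (fun t : nfa * (seq nat * seq nat) =>
    dfa_run (nstep t.1) t.2.1 t.2.2).
  by rewrite /dfa_run /nstep; comp.
by apply: (computable_comp (f := fun x => (A x, (s x, w x))) _ H); comp.
Qed.

Lemma computable_accepting (s : X -> seq nat) : computable s ->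
  computable (fun x => accepting (A x) (s x)).
Proof.
move=> hs.
have H : computable (fun t : nfa * seq nat => accepting t.1 t.2).
  by rewrite /accepting; comp.
by apply: (computable_comp (f := fun x => (A x, s x)) _ H); comp.
Qed.

Lemma computable_num_maps : computable (fun x => num_maps (A x)).
Proof. by rewrite /num_maps; comp. Qed.

Lemma computable_num_profiles : computable (fun x => num_profiles (A x)).
Proof. by have h := computable_num_maps; rewrite /num_profiles; comp. Qed.

Lemma computable_dfa_states : computable (fun x => dfa_states (A x)).
Proof. by rewrite /dfa_states /sublists; comp. Qed.
End Solver.

Ltac comp_dfa_hook ::=
  lazymatch goal with
  | |- computable (fun x => dfa_run (nstep _) _ _) => apply: computable_run
  | |- computable (fun x => accepting _ _) => apply: computable_accepting
  | |- computable (fun x => num_profiles _) => apply: computable_num_profiles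
  | |- computable (fun x => dfa_states _) => apply: computable_dfa_states
  end.

Lemma computable_domb {X : Type} {eX : encodable X} (A : X -> nfa)
    (s w : X -> seq nat) : computable A -> computable s -> computable w ->
  computable (fun x => domb (nstep (A x)) (accepting (A x)) (nsig (A x))
    (ngam (A x)) (num_profiles (A x)) (s x) (w x)).
Proof.
move=> hA hs hw.
have H : computable (fun t : nfa * (seq nat * seq nat) =>
    domb (nstep t.1) (accepting t.1) (nsig t.1) (ngam t.1) (num_profiles t.1)
      t.2.1 t.2.2).
  by rewrite /domb; comp.
by apply: (computable_comp (f := fun x => (A x, (s x, w x))) _ H); comp.
Qed.
Lemma computable_finb {X : Type} {eX : encodable X} (A : X -> nfa)
    (s w : X -> seq nat) : computable A -> computable s -> computable w ->
  computable (fun x => finb (nstep (A x)) (accepting (A x)) (nsig (A x))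
    (ngam (A x)) (num_profiles (A x)) (s x) (w x)).
Proof.
move=> hA hs hw.
have H : computable (fun t : nfa * (seq nat * seq nat) =>
    finb (nstep t.1) (accepting t.1) (nsig t.1) (ngam t.1) (num_profiles t.1)
      t.2.1 t.2.2).
  by rewrite /finb; comp; apply: computable_domb; comp.
by apply: (computable_comp (f := fun x => (A x, (s x, w x))) _ H); comp.
Qed.

Lemma computable_keepb {X : Type} {eX : encodable X} (A : X -> nfa)
    (s u v w : X -> seq nat) : computable A -> computable s ->
  computable u -> computable v -> computable w ->
  computable (fun x => keepb (nstep (A x)) (accepting (A x)) (nsig (A x))
    (ngam (A x)) (num_profiles (A x)) (s x) (u x) (v x) (w x)).
Proof.
move=> hA hs hu hv hw.
have H : computable (fun t : nfa * (seq nat * (seq nat * (seq nat * seq nat))) =>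
    keepb (nstep t.1) (accepting t.1) (nsig t.1) (ngam t.1) (num_profiles t.1)
      t.2.1 t.2.2.1 t.2.2.2.1 t.2.2.2.2).
  by rewrite /keepb; comp; apply: computable_domb; comp.
by apply: (computable_comp (f := fun x => (A x, (s x, (u x, (v x, w x))))) _ H); comp.
Qed.

Lemma computable_solvable : computable solvable.
Proof.
have P : computable (fun A => positions (nsig A) (num_profiles A) (dfa_states A)).
  by rewrite /positions; comp.
rewrite /solvable /solve /winning_region /restrict /safe; comp;
  first [ exact: (computable_comp (computable_fst computable_id) P)
        | apply: computable_finb; comp | apply: computable_keepb; comp ].
Qed.

Theorem mainTheorem1 :
  decidable_promise encode_nfa automatic_presentation
    has_finite_shiftlag_uniformizer.
Proof.
have [p hp] := computable_solvable; exists p => A autA.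
(* The code of a boolean is 1 or 0, exactly the two answers required. *)
have := solvable_correct autA; have : rf_eval p [:: encode_nfa A] (solvable A) := hp A.
by case: (solvable A) => hA [h1 h2]; split=> // h; [case: (h (h2 _))|case: (h1 h)].
Qed.
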